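(* Let $(\mathsf{Gen},\mathsf{Sign},\mathsf{Ver})$ be a one-time oracle signature scheme for messages $\{0,1\}^n$ in the random oracle model such that for every oracle, every key pair $(SK,VK)$ output by $\mathsf{Gen}$ with positive probability and every message $\alpha$, $\mathsf{Ver}(VK,\alpha,\mathsf{Sign}(SK,\alpha))$ accepts with probability at least $0.9$ over the randomness of $\mathsf{Ver}$, and which asks a total of $q\le \sqrt{n}/20$ oracle queries. Then there is (1) an adversary making $2^{(1+o(1))q}$ oracle queries that breaks the scheme with probability at least $2^{-q}$, and (2) an adversary making $2^{O(q^2)}$ oracle queries that breaks the scheme with constant probability.
   Context: Random oracle: a uniformly random function $\{0,1\}^\ell\to\{0,1\}^\ell$ for each length $\ell$, accessible only by queries. An oracle signature scheme is a triple of oracle algorithms $(\mathsf{Gen},\mathsf{Sign},\mathsf{Ver})$ where $\mathsf{Gen}$ outputs $(SK,VK)$; here $\mathsf{Ver}$ may be probabilistic. The total number of queries is counted over generating keys, signing one message and verifying that signature. Breaking the one-time scheme: the adversary receives $VK$, chooses a message $\alpha$ independently of $VK$, receives $\mathsf{Sign}(SK,\alpha)$, queries the oracle, and outputs $(\alpha^*,\sigma^* )$ with $\alpha^*\ne\alpha$ that $\mathsf{Ver}(VK,\alpha^*,\sigma^* )$ accepts; probabilities are over the oracle and all coins (including the verifier's). The $o(1)$ term tends to $0$ as $q\to\infty$. *)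

(* Defs.v *)
From HB Require Import structures.
From mathcomp Require Import all_boot all_order all_algebra.
From mathcomp Require Import all_classical all_reals all_analysis.
Set Implicit Arguments.
Unset Strict Implicit.
Unset Printing Implicit Defensive.
Import Order.TTheory GRing.Theory Num.Theory.
Import numFieldNormedType.Exports.

Local Open Scope ring_scope.

Definition oracle := forall l : nat, l.-tuple bool -> l.-tuple bool.

(* A computationally unbounded probabilistic oracle algorithm that always halts
   and returns a value of type A, given by its decision tree: [Ask x k] sends
   the query x and continues with k applied to the answer, and [Rand m k]
   draws i uniformly from {0, ..., m} and continues with k i.  All branchings
   are finite, so the tree has bounded depth. *)
Inductive ocomp (A : Type) : Type :=
| Ret of A
| Ask (l : nat) of l.-tuple bool & (l.-tuple bool -> ocomp A)
| Rand (m : nat) of ('I_m.+1 -> ocomp A).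
Arguments Ret {A}.
Arguments Ask {A l}.
Arguments Rand {A m}.

Fixpoint obind (A B : Type) (c : ocomp A) (f : A -> ocomp B) : ocomp B :=
  match c with
  | Ret a => f a
  | Ask _ x k => Ask x (fun y => obind (k y) f)
  | Rand _ k => Rand (fun i => obind (k i) f)
  end.

(* Probability, over the coins only, that c run with the fixed oracle O returns
   a value satisfying E. *)
Fixpoint coin_pr (R : realType) (A : Type) (O : oracle) (c : ocomp A)
    (E : A -> bool) : R :=
  match c with
  | Ret a => (E a)%:R
  | Ask l x k => coin_pr R O (k (O l x)) E
  | Rand m k => (\sum_(i < m.+1) coin_pr R O (k i) E) / m.+1%:R
  end.

(* Largest number of queries, over all coins, that c asks when run with O. *)
Fixpoint nqueries (A : Type) (O : oracle) (c : ocomp A) : nat :=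
  match c with
  | Ret _ => 0
  | Ask l x k => (nqueries O (k (O l x))).+1
  | Rand m k => \max_(i < m.+1) nqueries O (k i)
  end.

(* A strict bound on the lengths of all queries occurring in the tree c. *)
Fixpoint qlen (A : Type) (c : ocomp A) : nat :=
  match c with
  | Ret _ => 0
  | Ask l x k => maxn l.+1 (\max_(y : l.-tuple bool) qlen (k y))
  | Rand m k => \max_(i < m.+1) qlen (k i)
  end.

(* The restrictions of oracles to the lengths l < L. *)
Definition foracle (L : nat) :=
  {dffun forall l : 'I_L, {ffun l.-tuple bool -> l.-tuple bool}}.

(* The values outside the lengths l < L are irrelevant. *)
Definition extend (L : nat) (f : foracle L) : oracle := fun l =>
  match decP (@idP (l < L)%N) with
  | left lL => fun x => f (Ordinal lL) x
  | right _ => fun x => x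
  end.

Definition ro_pr_upto (R : realType) (A : Type) (L : nat) (c : ocomp A)
    (E : A -> bool) : R :=
  (\sum_(f : foracle L) coin_pr R (extend f) c E) / #|{: foracle L}|%:R.

(* Probability over a uniformly random oracle and all coins.  The algorithm c
   depends only on the restriction of the oracle to lengths l < qlen c, which
   is uniformly distributed over the finite set foracle (qlen c); by
   ro_pr_uptoE any larger bound on the lengths gives the same value. *)
Definition ro_pr (R : realType) (A : Type) (c : ocomp A) (E : A -> bool) : R :=
  ro_pr_upto R (qlen c) c E.

Lemma coin_pr_ext (R : realType) (A : Type) (O1 O2 : oracle) (c : ocomp A)
    (E : A -> bool) :
  (forall l, (l < qlen c)%N -> O1 l =1 O2 l) ->
  coin_pr R O1 c E = coin_pr R O2 c E.
Proof.
elim: c => [a|l x k IH|m k IH] //= eqO.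
- rewrite eqO; last by rewrite leq_max ltnSn.
  apply: IH => j jlt; apply: eqO; rewrite leq_max; apply/orP; right.
  by apply: leq_trans jlt _; apply: (leq_bigmax (F := fun y => qlen (k y))).
- congr (_ / _); apply: eq_bigr => i _; apply: IH => j jlt; apply: eqO.
  by apply: leq_trans jlt _; apply: (leq_bigmax (F := fun y => qlen (k y))).
Qed.

Lemma extendE (L : nat) (f : foracle L) (l : 'I_L) (x : l.-tuple bool) :
  extend f x = f l x.
Proof.
rewrite /extend; case: decP => [lL|/negP]; last by rewrite ltn_ord.
have e : Ordinal lL = l by apply: val_inj.
by case: l x lL e => l lL' x lL e; rewrite (bool_irrelevance lL lL').
Qed.

Section Restriction.
Variables (L0 L : nat) (leL : (L0 <= L)%N).

Definition frestr (f : foracle L) : foracle L0 :=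
  [ffun l : 'I_L0 => f (widen_ord leL l)].

Definition foverwrite (g : foracle L0) (f : foracle L) : foracle L :=
  [ffun l : 'I_L =>
     if (l < L0)%N then [ffun x : l.-tuple bool => extend g x] else f l].

Lemma frestr_overwrite g f : frestr (foverwrite g f) = g.
Proof.
apply/ffunP => l; rewrite !ffunE /= ltn_ord.
by apply/ffunP => x; rewrite ffunE extendE.
Qed.

Lemma card_fiber g g' :
  #|[pred f | frestr f == g]| = #|[pred f | frestr f == g']|.
Proof.
wlog suff: g g' / (#|[pred f | frestr f == g]| <= #|[pred f | frestr f == g']|)%N.
  by move=> H; apply/eqP; rewrite eqn_leq !H.
rewrite -(card_in_imset (f := foverwrite g')) => [|f1 f2].
  apply: subset_leq_card; apply/fintype.subsetP => f /imsetP[f' _ ->].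
  by rewrite inE frestr_overwrite.
rewrite !inE => /eqP e1 /eqP e2 e; apply/ffunP => l.
case: (ltnP l L0) => lL0.
  have /ffunP/(_ (Ordinal lL0)) : frestr f1 = frestr f2 by rewrite e1.
  have eq_at l' : l' = l -> f1 l' = f2 l' -> f1 l = f2 l by move=> ->.
  rewrite !ffunE; apply: (eq_at (widen_ord leL (Ordinal lL0))).
  exact: val_inj.
by move/ffunP/(_ l): e; rewrite !ffunE ltnNge lL0.
Qed.

End Restriction.

Lemma ro_pr_uptoE (R : realType) (A : Type) (L : nat) (c : ocomp A)
    (E : A -> bool) :
  (qlen c <= L)%N -> ro_pr_upto R L c E = ro_pr R c E.
Proof.
move=> leL; rewrite /ro_pr /ro_pr_upto.
pose g0 : foracle (qlen c) := [ffun l => [ffun x => x]].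
pose N := #|[pred f | frestr leL f == g0]|.
have N_gt0 : (0 < N)%N.
  apply/card_gt0P.
  exists (foverwrite g0 [ffun l : 'I_L => [ffun x : l.-tuple bool => x]]).
  by rewrite inE frestr_overwrite.
have avg (G : foracle (qlen c) -> R) :
    \sum_(f : foracle L) G (frestr leL f) = (\sum_g G g) * N%:R.
  rewrite (partition_big (frestr leL) predT) //= mulr_suml.
  apply: eq_bigr => g _; rewrite (eq_bigr (fun=> G g)); last by move=> f /eqP ->.
  by rewrite sumr_const (card_fiber leL g g0) mulr_natr.
have -> : \sum_(f : foracle L) coin_pr R (extend f) c E
    = \sum_(f : foracle L) coin_pr R (extend (frestr leL f)) c E.
  apply: eq_bigr => f _; apply: coin_pr_ext => l lq x.
  rewrite (extendE (frestr leL f) (l := Ordinal lq)) ffunE.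
  by rewrite -(extendE f (l := widen_ord leL (Ordinal lq))).
rewrite (avg (fun g => coin_pr R (extend g) c E)).
have -> : #|{: foracle L}|%:R = #|{: foracle (qlen c)}|%:R * N%:R :> R.
  by have := avg (fun=> 1); rewrite !sumr_const.
by rewrite -mulf_div divff ?mulr1 // pnatr_eq0 -lt0n.
Qed.

(* gen returns the pair (SK, VK); ver takes VK, a message and a signature. *)
Record sigScheme (n : nat) := SigScheme {
  gen : ocomp (bitseq * bitseq);
  sign : bitseq -> n.-tuple bool -> ocomp bitseq;
  ver : bitseq -> n.-tuple bool -> bitseq -> ocomp bool
}.

Definition honest_run (n : nat) (S : sigScheme n) (m : n.-tuple bool) :
    ocomp bool :=
  obind (gen S) (fun k =>
  obind (sign S k.1 m) (fun s => ver S k.2 m s)).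

Definition total_queries_le (n : nat) (S : sigScheme n) (q : nat) : Prop :=
  forall (O : oracle) (m : n.-tuple bool), (nqueries O (honest_run S m) <= q)%N.

(* Completeness error at most 1 - p over the coins of ver alone: the bound is
   required for every signature that sign can output. *)
Definition complete_with (R : realType) (n : nat) (S : sigScheme n) (p : R) :
    Prop :=
  forall (O : oracle) (sk vk : bitseq) (m : n.-tuple bool) (s : bitseq),
    0 < coin_pr R O (gen S) (pred1 (sk, vk)) ->
    0 < coin_pr R O (sign S sk m) (pred1 s) ->
    p <= coin_pr R O (ver S vk m s) id.

(* The message to be signed is chosen from coins alone, hence independently of
   the verification key; forge receives VK, the message and its signature. *)
Record adversary (n : nat) := Adversary {
  choose : ocomp (n.-tuple bool);
  choose_noquery : forall O : oracle, nqueries O choose = 0%N;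
  forge : bitseq -> n.-tuple bool -> bitseq -> ocomp (n.-tuple bool * bitseq)
}.

Definition adv_queries_le (R : realType) (n : nat) (A : adversary n) (B : R) :
    Prop :=
  forall (O : oracle) (vk : bitseq) (m : n.-tuple bool) (s : bitseq),
    (nqueries O (forge A vk m s))%:R <= B.

Definition break_game (n : nat) (S : sigScheme n) (A : adversary n) :
    ocomp bool :=
  obind (gen S) (fun k =>
  obind (choose A) (fun m =>
  obind (sign S k.1 m) (fun s =>
  obind (forge A k.2 m s) (fun ms =>
  if ms.1 == m then Ret false else ver S k.2 ms.1 ms.2)))).

Definition break_pr (R : realType) (n : nat) (S : sigScheme n)
    (A : adversary n) : R :=
  ro_pr R (break_game S A) id.

(* Main.v *)
(* Let G, S_a and V_a be the sets of queries asked by Gen, by Sign on the message a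
   and by Ver on a and its signature.  After verifying the signature of a0 the
   adversary repeatedly draws a fake world (a random oracle with coins of Gen and
   Sign) uniformly among those compatible with the verification key, the signature
   and all queries asked so far, and signs another message a1 in the hybrid oracle
   that answers as the fake world on the fake sets G, S_a0 and as the real oracle
   elsewhere.  Completeness holds for the hybrid oracle, so the forgery is accepted
   by the real one as soon as its verification avoids the fake queries that are not
   yet known.  Exchanging the two oracles outside both transcripts shows that a
   round behaves as if a0 and a1 had been signed honestly, unless it asks an unknown
   query of the real G, S_a0; this reveals that query, so at most q rounds are bad,
   and a random one of many rounds is good.  For two honest signatures, Bollobas'
   set-pair inequality bounds from below the probability that V_a1 is disjoint from
   (G u S_a0) \ V_a0: the sets (G u S_a) \ V_a and V_a are disjoint and have at most
   q elements together.  For constant success probability V_a0 is the union over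
   many verifications, and the adversary looks for a candidate a1 that passes many
   test verifications. *)

From Pilot Require Import Defs.
From mathcomp Require Import all_boot all_order all_algebra perm.
From mathcomp Require Import all_classical all_reals all_analysis.
From mathcomp Require Import ring lra zify.
(* Restores [Defs.obind], which [ssrfun.obind] shadows. *)
Import Pilot.Defs.
Set Implicit Arguments.
Unset Strict Implicit.
Unset Printing Implicit Defensive.
Import Order.TTheory GRing.Theory Num.Theory.
Import numFieldNormedType.Exports.

Local Open Scope ring_scope.

(** * Expectations, traces and query bounds of oracle computations *)

Definition query := {l : nat & l.-tuple bool}.
Definition qry (l : nat) (x : l.-tuple bool) : query := Tagged (fun l => l.-tuple bool) x.
Definition answer (O : oracle) (x : query) : query := qry (O (tag x) (tagged x)).

Fixpoint cex (R : realType) (A : Type) (O : oracle) (c : ocomp A)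
    (F : A -> R) : R :=
  match c with
  | Ret a => F a
  | Ask l x k => cex O (k (O l x)) F
  | Rand m k => (\sum_(i < m.+1) cex O (k i) F) / m.+1%:R
  end.

Fixpoint supp (A : Type) (O : oracle) (c : ocomp A) (a : A) : Prop :=
  match c with
  | Ret b => b = a
  | Ask l x k => supp O (k (O l x)) a
  | Rand m k => exists i, supp O (k i) a
  end.

Fixpoint trace (A : Type) (c : ocomp A) : ocomp (A * seq query) :=
  match c with
  | Ret a => Ret (a, [::])
  | Ask l x k => Ask x (fun y => obind (trace (k y)) (fun p => Ret (p.1, qry x :: p.2)))
  | Rand m k => Rand (fun i => trace (k i))
  end.

Definition mixO (Q : seq query) (O' O : oracle) : oracle :=
  fun l x => if qry x \in Q then O' l x else O l x.

(* Runs [c] with the answers to queries in [Q] replaced by those of [O'], while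
   still asking every query; the genuine query-answer pairs are returned. *)
Fixpoint patched (A : Type) (Q : seq query) (O' : oracle) (c : ocomp A) :
    ocomp (A * seq (query * query)) :=
  match c with
  | Ret a => Ret (a, [::])
  | Ask l x k => Ask x (fun y =>
      obind (patched Q O' (k (if qry x \in Q then O' l x else y)))
        (fun p => Ret (p.1, (qry x, qry y) :: p.2)))
  | Rand m k => Rand (fun i => patched Q O' (k i))
  end.

(** The cut enforces the bounds on queries and lengths for every oracle and input, in particular in
    hybrid oracles. Runs within the bounds are not affected. *)
Fixpoint cap (A : Type) (q L : nat) (c : ocomp A) : ocomp (option A) :=
  match c with
  | Ret a => Ret (Some a)
  | Ask l x k =>
    if q is q'.+1 then
      if (l < L)%N then Ask x (fun y => cap q' L (k y)) else Ret None
    else Ret None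
  | Rand m k => Rand (fun i => cap q L (k i))
  end.

(** [Rand m] has [m.+1] branches, whence [.-1.+1]; for the empty list the result is [x0]. *)
Definition unif (T : Type) (x0 : T) (s : seq T) : ocomp T :=
  Rand (fun i : 'I_(size s).-1.+1 => Ret (nth x0 s i)).

Section Cex.
Variable R : realType.
Implicit Types (A B : Type) (O : oracle).

Lemma coin_prE A O (c : ocomp A) E : coin_pr R O c E = cex O c (fun a => (E a)%:R).
Proof.
elim: c => [a|l x k IH|m k IH] //=.
by congr (_ / _); apply: eq_bigr => i _; apply: IH.
Qed.

Lemma cex_obind A B O (c : ocomp A) (f : A -> ocomp B) (F : B -> R) :
  cex O (obind c f) F = cex O c (fun a => cex O (f a) F).
Proof.
elim: c => [a|l x k IH|m k IH] //=.
by congr (_ / _); apply: eq_bigr => i _; apply: IH.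
Qed.

Lemma cex_le_supp A O (c : ocomp A) (F G : A -> R) :
  (forall a, supp O c a -> F a <= G a) -> cex O c F <= cex O c G.
Proof.
elim: c => [a|l x k IH|m k IH] /= H; first exact: H.
  exact: IH.
rewrite ler_pM2r ?invr_gt0 ?ltr0n //; apply: ler_sum => i _.
by apply: IH => a ha; apply: H; exists i.
Qed.

Lemma cex_le A O (c : ocomp A) (F G : A -> R) :
  (forall a, F a <= G a) -> cex O c F <= cex O c G.
Proof. by move=> H; apply: cex_le_supp => a _. Qed.

Lemma cex_eq_supp A O (c : ocomp A) (F G : A -> R) :
  (forall a, supp O c a -> F a = G a) -> cex O c F = cex O c G.
Proof. by move=> H; apply/le_anti/andP; split; apply: cex_le_supp => a /H ->. Qed.

Lemma cex_eq A O (c : ocomp A) (F G : A -> R) : F =1 G -> cex O c F = cex O c G.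
Proof. by move=> H; apply: cex_eq_supp => a _. Qed.

Lemma cex_const A O (c : ocomp A) (a : R) : cex O c (fun=> a) = a.
Proof.
elim: c => [b|l x k IH|m k IH] //=.
by rewrite (eq_bigr _ (fun i _ => IH i)) sumr_const card_ord -[a *+ _]mulr_natr mulfK ?pnatr_eq0.
Qed.

Lemma cexD A O (c : ocomp A) (F G : A -> R) :
  cex O c (fun a => F a + G a) = cex O c F + cex O c G.
Proof.
elim: c => [b|l x k IH|m k IH] //=.
by rewrite (eq_bigr _ (fun i _ => IH i)) big_split mulrDl.
Qed.

Lemma cexZ A O (c : ocomp A) (a : R) (F : A -> R) :
  cex O c (fun x => a * F x) = a * cex O c F.
Proof.
elim: c => [b|l x k IH|m k IH] //=.
by rewrite (eq_bigr _ (fun i _ => IH i)) -mulr_sumr mulrA.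
Qed.

Lemma cexN A O (c : ocomp A) (F : A -> R) : cex O c (fun x => - F x) = - cex O c F.
Proof.
by rewrite -mulN1r -cexZ; apply: cex_eq => a; rewrite mulN1r.
Qed.

Lemma cexB A O (c : ocomp A) (F G : A -> R) :
  cex O c (fun a => F a - G a) = cex O c F - cex O c G.
Proof. by rewrite cexD cexN. Qed.

Lemma cex_sum A O (c : ocomp A) (I : Type) (r : seq I) (P : pred I) (F : I -> A -> R) :
  cex O c (fun a => \sum_(i <- r | P i) F i a) = \sum_(i <- r | P i) cex O c (F i).
Proof.
elim: r => [|i r IH].
  by rewrite big_nil -[RHS](cex_const O c); apply: cex_eq => a; rewrite big_nil.
rewrite big_cons -IH; case: ifP => Pi.
  by rewrite -cexD; apply: cex_eq => a; rewrite big_cons Pi.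
by apply: cex_eq => a; rewrite big_cons Pi.
Qed.

Lemma cex_exchange A B O (c : ocomp A) (d : ocomp B) (F : A -> B -> R) :
  cex O c (fun a => cex O d (F a)) = cex O d (fun b => cex O c (fun a => F a b)).
Proof.
elim: c => [b|l x k IH|m k IH] //=.
rewrite (eq_bigr _ (fun i _ => IH i)) -cex_sum mulrC -cexZ.
by apply: cex_eq => b; rewrite mulrC.
Qed.

Lemma cex_ge0 A O (c : ocomp A) (F : A -> R) :
  (forall a, supp O c a -> 0 <= F a) -> 0 <= cex O c F.
Proof. by move=> H; rewrite -(cex_const O c 0); apply: cex_le_supp. Qed.

Lemma supp_obind A B O (c : ocomp A) (f : A -> ocomp B) b :
  supp O (obind c f) b <-> exists2 a, supp O c a & supp O (f a) b.
Proof.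
elim: c => [a|l x k IH|m k IH] //=.
  by split => [|[a' <-]] //; exists a.
split=> [[i /IH[a]]|[a [i]]]; first by exists a => //; exists i.
by move=> h1 h2; exists i; apply/IH; exists a.
Qed.

Lemma supp_coin_pr A O (c : ocomp A) a (E : A -> bool) : supp O c a -> E a -> 0 < coin_pr R O c E.
Proof.
elim: c => [b|l x k IH|m k IH] /=; first by move=> -> ->.
  exact: IH.
move=> [i si] Ea; rewrite divr_gt0 ?ltr0n // (bigD1 i) //=.
rewrite ltr_wpDr ?IH //; apply: sumr_ge0 => j _.
by rewrite coin_prE; apply: cex_ge0.
Qed.

Lemma cex_trace A O (c : ocomp A) (F : A -> R) :
  cex O (trace c) (fun p => F p.1) = cex O c F.
Proof.
elim: c => [b|l x k IH|m k IH] //=; first by rewrite cex_obind /= IH.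
by congr (_ / _); apply: eq_bigr => i _; apply: IH.
Qed.

Lemma trace_supp A O (c : ocomp A) p : supp O (trace c) p -> supp O c p.1.
Proof.
elim: c p => [b|l x k IH|m k IH] p /=; first by move=> <-.
  by move=> /supp_obind[p' /IH h <-].
by move=> [i /IH h]; exists i.
Qed.

Lemma cex_trace_obind A B O (c : ocomp A) (f : A -> ocomp B) (F : B * seq query -> R) :
  cex O (trace (obind c f)) F =
  cex O (trace c) (fun p => cex O (trace (f p.1)) (fun p' => F (p'.1, p.2 ++ p'.2))).
Proof.
elim: c F => [b|l x k IH|m k IH] F /=.
- by apply: cex_eq => -[].
- by rewrite !cex_obind /= IH.
- by congr (_ / _); apply: eq_bigr => i _; apply: IH.
Qed.

Lemma cex_patch A O Q O' (c : ocomp A) (F : A * seq (query * query) -> R) :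
  cex O (patched Q O' c) F =
  cex (mixO Q O' O) (trace c) (fun p => F (p.1, [seq (x, answer O x) | x <- p.2])).
Proof.
elim: c F => [b|l x k IH|m k IH] F //=.
  by rewrite /mixO !cex_obind IH.
by congr (_ / _); apply: eq_bigr => i _; apply: IH.
Qed.

Lemma cex_ext A O1 O2 (c : ocomp A) (F : A -> R) :
  (forall l, O1 l =1 O2 l) -> cex O1 c F = cex O2 c F.
Proof.
move=> e; elim: c => [b|l x k IH|m k IH] //=; first by rewrite e IH.
by congr (_ / _); apply: eq_bigr => i _; apply: IH.
Qed.

(** Runs with the two oracles coincide until the first query in [Y], and a run that asks such a
    query is counted on the right whatever follows. *)
Lemma coin_pr_until A O1 O2 (c : ocomp A) (Y : pred query) (E : A * seq query -> bool) :
  (forall l x, ~~ Y (@qry l x) -> O1 l x = O2 l x) ->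
  coin_pr R O2 (trace c) E <= coin_pr R O1 (trace c) (fun p => E p || has Y p.2).
Proof.
rewrite !coin_prE => e.
elim: c E => [b|l x k IH|m k IH] E /=; first by rewrite orbF.
  rewrite !cex_obind /=.
  case: (boolP (Y (qry x))) => Yx.
    apply: (@le_trans _ _ 1).
      by rewrite -[leRHS](cex_const O2 (trace (k (O2 l x)))); apply: cex_le => p; case: (E _); rewrite ?ler01.
    rewrite -[leLHS](cex_const O1 (trace (k (O1 l x)))); by apply: cex_le => p; rewrite orbT.
  rewrite (e _ _ Yx); apply: le_trans (IH _ _) _.
  by apply: cex_le => p.
rewrite ler_pM2r ?invr_gt0 ?ltr0n //; apply: ler_sum => i _; exact: IH.
Qed.

(** A run with [O2] that never asks a query in [Y] is at the same time a run with [O1]. *)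
Lemma coin_pr_untilF A O1 O2 (c : ocomp A) (Y : pred query) (E : A -> bool) :
  (forall l x, ~~ Y (@qry l x) -> O1 l x = O2 l x) ->
  coin_pr R O2 (trace c) (fun p => E p.1 && ~~ has Y p.2) <= coin_pr R O1 c E.
Proof.
rewrite !coin_prE => e.
elim: c E => [b|l x k IH|m k IH] E /=; first by rewrite andbT.
  rewrite !cex_obind /=.
  case: (boolP (Y (qry x))) => Yx.
    rewrite (cex_eq _ _ (G := fun=> 0)); last by move=> p; rewrite andbF.
    by rewrite cex_const; apply: cex_ge0.
  rewrite (e _ _ Yx); apply: le_trans (IH _ _).
  by apply: cex_le => p.
rewrite ler_pM2r ?invr_gt0 ?ltr0n //; apply: ler_sum => i _; exact: IH.
Qed.

Lemma cex_unif (T : Type) O (x0 : T) (s : seq T) (F : T -> R) :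
  (0 < size s)%N -> cex O (unif x0 s) F = (\sum_(x <- s) F x) / (size s)%:R.
Proof.
move=> s0; rewrite /unif /= prednK //; congr (_ / _).
by rewrite (big_nth x0) big_mkord.
Qed.

Lemma supp_unif (T : eqType) O (x0 : T) (s : seq T) x :
  (0 < size s)%N -> supp O (unif x0 s) x -> x \in s.
Proof. by move=> s0 [i <-]; rewrite mem_nth // -[ltnRHS]prednK. Qed.

End Cex.

(** * Bounds on the number and the lengths of queries *)

Section Nqueries.
Implicit Types (A B : Type) (O : oracle).

Lemma nqueries_obind A B O (c : ocomp A) (f : A -> ocomp B) (a b : nat) :
  (nqueries O c <= a)%N -> (forall x, nqueries O (f x) <= b)%N ->
  (nqueries O (obind c f) <= a + b)%N.
Proof.
move=> + hf; elim: c a => [x|l x k IH|m k IH] a /=.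
- by move=> _; rewrite (leq_trans (hf _)) // leq_addl.
- by case: a => // a /IH h; rewrite addSn ltnS.
- move=> /bigmax_leqP h; apply/bigmax_leqP => i _; apply: IH; exact: h.
Qed.

Lemma nqueries_cap A O q L (c : ocomp A) : (nqueries O (cap q L c) <= q)%N.
Proof.
elim: c q => [x|l x k IH|m k IH] q //=; last by apply/bigmax_leqP => i _.
by case: q => // q; case: ifP => //= _; rewrite ltnS.
Qed.

Lemma nqueries_cap_le A O q L (c : ocomp A) : (nqueries O (cap q L c) <= nqueries O c)%N.
Proof.
elim: c q => [x|l x k IH|m k IH] q //=; first by case: q => // q; case: ifP => //= _; rewrite ltnS.
apply/bigmax_leqP => i _; apply: leq_trans (IH i q) _.
exact: (leq_bigmax (F := fun i => nqueries O (k i))).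
Qed.

Lemma nqueries_obind_ret A B O (c : ocomp A) (f : A -> B) :
  nqueries O (obind c (fun x => Ret (f x))) = nqueries O c.
Proof.
elim: c => [x|l x k IH|m k IH] //=; first by rewrite IH.
by apply: eq_bigr.
Qed.

Lemma nqueries_trace A O (c : ocomp A) : nqueries O (trace c) = nqueries O c.
Proof.
elim: c => [x|l x k IH|m k IH] //=; last by apply: eq_bigr.
by rewrite nqueries_obind_ret IH.
Qed.

Lemma nqueries_patch A O Q O' (c : ocomp A) :
  nqueries O (patched Q O' c) = nqueries (mixO Q O' O) c.
Proof.
elim: c => [x|l x k IH|m k IH] //=; last by apply: eq_bigr.
by rewrite nqueries_obind_ret IH.
Qed.

Lemma nqueries_unif T O (x0 : T) s : nqueries O (unif x0 s) = 0%N.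
Proof. by apply/eqP; rewrite -leqn0; apply/bigmax_leqP. Qed.

Lemma qlen_obind A B L (c : ocomp A) (f : A -> ocomp B) :
  (qlen c <= L)%N -> (forall x, qlen (f x) <= L)%N -> (qlen (obind c f) <= L)%N.
Proof.
move=> + hf; elim: c => [x|l x k IH|m k IH] //=.
  rewrite !geq_max => /andP[-> /bigmax_leqP h] /=.
  by apply/bigmax_leqP => y _; apply: IH; apply: h.
by move=> /bigmax_leqP h; apply/bigmax_leqP => i _; apply: IH; apply: h.
Qed.

(** Serves to compare the breaking game with the honest run, which begins in the same way. *)
Lemma qlen_obind_mono A B B' L (c : ocomp A) (f : A -> ocomp B) (g : A -> ocomp B') :
  (forall x, qlen (g x) <= L -> qlen (f x) <= L)%N ->
  (qlen (obind c g) <= L)%N -> (qlen (obind c f) <= L)%N.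
Proof.
move=> hf; elim: c => [x|l x k IH|m k IH] //=; first exact: hf.
  rewrite !geq_max => /andP[-> /bigmax_leqP h] /=.
  by apply/bigmax_leqP => y _; apply: IH; apply: h.
by move=> /bigmax_leqP h; apply/bigmax_leqP => i _; apply: IH; apply: h.
Qed.

Lemma qlen_cap A q L (c : ocomp A) : (qlen (cap q L c) <= L)%N.
Proof.
elim: c q => [x|l x k IH|m k IH] q //=; last by apply/bigmax_leqP => i _.
case: q => // q; case: ifP => //= lL; rewrite geq_max lL /=.
by apply/bigmax_leqP => y _.
Qed.

Lemma qlen_trace A L (c : ocomp A) : (qlen c <= L)%N -> (qlen (trace c) <= L)%N.
Proof.
elim: c => [x|l x k IH|m k IH] //=; last first.
  by move=> /bigmax_leqP h; apply/bigmax_leqP => i _; apply: IH; apply: h.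
rewrite !geq_max => /andP[-> /bigmax_leqP h] /=.
by apply/bigmax_leqP => y _; apply: qlen_obind => //; apply: IH; apply: h.
Qed.

Lemma qlen_patch A L Q O' (c : ocomp A) : (qlen c <= L)%N -> (qlen (patched Q O' c) <= L)%N.
Proof.
elim: c => [x|l x k IH|m k IH] //=; last first.
  by move=> /bigmax_leqP h; apply/bigmax_leqP => i _; apply: IH; apply: h.
rewrite !geq_max => /andP[-> /bigmax_leqP h] /=.
by apply/bigmax_leqP => y _; apply: qlen_obind => //; apply: IH; apply: h.
Qed.

Lemma qlen_unif T L (x0 : T) s : (qlen (unif x0 s) <= L)%N.
Proof. by rewrite /unif /=; apply/bigmax_leqP. Qed.

Lemma supp_qlen A B O L (c : ocomp A) (f : A -> ocomp B) a :
  supp O c a -> (qlen (obind c f) <= L)%N -> (qlen (f a) <= L)%N.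
Proof.
elim: c => [x|l x k IH|m k IH] /=; first by move=> ->.
  rewrite geq_max => h /andP[_ /bigmax_leqP H].
  exact: IH h (H _ _).
by move=> [i h] /bigmax_leqP H; apply: IH h (H _ _).
Qed.

(** A possible run followed by a worst case of the continuation is a run of the whole. This turns
    the bound on all queries into one on the total size of the query sets of key generation, signing
    and verification. *)
Lemma supp_nqueries A B O (c : ocomp A) (f : A -> ocomp B) p :
  supp O (trace c) p -> (size p.2 + nqueries O (f p.1) <= nqueries O (obind c f))%N.
Proof.
elim: c p => [x|l x k IH|m k IH] p /=; first by move=> <-.
  by move=> /supp_obind[p' /IH h <-] /=; rewrite addSn ltnS.
move=> [i /IH h]; apply: leq_trans h _.
exact: (leq_bigmax (F := fun i => nqueries O (obind (k i) f))).
Qed.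

Lemma supp_size A O (c : ocomp A) p : supp O (trace c) p -> (size p.2 <= nqueries O c)%N.
Proof.
move=> /(supp_nqueries (fun=> Ret tt)); rewrite addn0.
by rewrite (nqueries_obind_ret O c (fun=> tt)).
Qed.

Lemma nqueries_obind_le A B O (c : ocomp A) (f : A -> ocomp B) :
  (nqueries O c <= nqueries O (obind c f))%N.
Proof.
elim: c => [x|l x k IH|m k IH] //=; first by rewrite ltnS.
apply/bigmax_leqP => i _; apply: leq_trans (IH i) _.
exact: (leq_bigmax (F := fun i => nqueries O (obind (k i) f))).
Qed.

Lemma qlen_obind_le A B (c : ocomp A) (f : A -> ocomp B) :
  (qlen c <= qlen (obind c f))%N.
Proof.
elim: c => [x|l x k IH|m k IH] //=.
  rewrite geq_max leq_maxl /=; apply/bigmax_leqP => y _; apply: leq_trans (IH y) _.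
  rewrite leq_max; apply/orP; right.
  exact: (leq_bigmax (F := fun i => qlen (obind (k i) f))).
apply/bigmax_leqP => i _; apply: leq_trans (IH i) _.
exact: (leq_bigmax (F := fun i => qlen (obind (k i) f))).
Qed.

Lemma supp_tag A O (c : ocomp A) L p :
  (qlen c <= L)%N -> supp O (trace c) p -> all (fun x : query => tag x < L)%N p.2.
Proof.
elim: c p => [x|l x k IH|m k IH] p /=; first by move=> _ <-.
  rewrite geq_max => /andP[lL /bigmax_leqP h] /supp_obind[p' s <-] /=.
  by rewrite lL /=; apply: IH s; apply: h.
by move=> /bigmax_leqP h [i s]; apply: IH s; apply: h.
Qed.

Lemma cex_cap (R : realType) A O q L (c : ocomp A) (F : option A * seq query -> R) :
  (nqueries O c <= q)%N -> (qlen c <= L)%N ->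
  cex O (trace (cap q L c)) F = cex O (trace c) (fun p => F (Some p.1, p.2)).
Proof.
elim: c q F => [x|l x k IH|m k IH] q F //=.
  case: q => // q; rewrite ltnS geq_max => h /andP[lL /bigmax_leqP h'].
  by rewrite lL /= !cex_obind /= IH //; apply: h'.
move=> /bigmax_leqP h /bigmax_leqP h'.
by congr (_ / _); apply: eq_bigr => i _; apply: IH; [apply: h|apply: h'].
Qed.

Lemma coin_pr_cap (R : realType) A O q L (c : ocomp A) (E : A -> bool) :
  coin_pr R O (cap q L c) (fun o => if o is Some a then E a else false)
  <= coin_pr R O c E.
Proof.
rewrite !coin_prE.
elim: c q => [x|l x k IH|m k IH] q //=.
  have h0 : 0 <= cex O (k (O l x)) (fun a => (E a)%:R) :> R by apply: cex_ge0.
  by case: q => //= q; case: ifP => //= _; apply: IH.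
by rewrite ler_pM2r ?invr_gt0 ?ltr0n //; apply: ler_sum => i _; apply: IH.
Qed.

End Nqueries.

(** * Set pairs and random orderings *)

Section Orders.
Variable T : finType.
Implicit Types (A B X : {set T}) (p : {perm T}).

Definition before p A B : bool :=
  [forall a in A, forall b in B, (enum_rank (p a) < enum_rank (p b))%N].

Lemma beforeP p A B :
  reflect (forall a b, a \in A -> b \in B -> (enum_rank (p a) < enum_rank (p b))%N)
          (before p A B).
Proof.
apply: (iffP forallP) => [h a b aA bB|h a].
  by have /implyP/(_ aA)/forallP/(_ b)/implyP/(_ bB) := h a.
by apply/implyP => aA; apply/forallP => b; apply/implyP => bB; apply: h.
Qed.

(* If both pairs are ordered by [p], the one whose first part ends earlier has
   its first part disjoint from the second part of the other. *)
Lemma before_cross p A1 B1 A2 B2 :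
  before p A1 B1 -> before p A2 B2 -> [disjoint A1 & B2] || [disjoint A2 & B1].
Proof.
move=> /beforeP h1 /beforeP h2; apply/norP => -[].
rewrite -!finset.setI_eq0 => /finset.set0Pn[x] /finset.setIP[xA1 xB2] /finset.set0Pn[y] /finset.setIP[yA2 yB1].
by have := ltn_trans (h1 _ _ xA1 yB1) (h2 _ _ yA2 xB2); rewrite ltnn.
Qed.

Lemma perm_of_lists (s1 s2 : seq T) :
  uniq s1 -> uniq s2 -> size s1 = #|T| -> size s2 = #|T| ->
  exists p : {perm T}, forall x, p x = nth x s2 (index x s1).
Proof.
move=> u1 u2 e1 e2.
have in1 x : x \in s1.
  have := (@uniq_min_size _ s1 (enum T) u1); rewrite -cardE e1 leqnn.
  case=> // [y _|_]; first by rewrite mem_enum.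
  by move=> ->; rewrite mem_enum.
have inj : injective (fun x => nth x s2 (index x s1)).
  move=> x y; rewrite (set_nth_default y) ?e2 -?e1 ?index_mem // => /eqP.
  rewrite nth_uniq // ?e2 -?e1 ?index_mem // => /eqP /(congr1 (nth x s1)).
  by rewrite !nth_index.
by exists (perm inj) => x; rewrite permE.
Qed.

(** The concatenated enumerations of [A'], [X :\: A'] and [~: X] are matched position by position
    with those of [A], [X :\: A] and [~: X]; corresponding blocks have equal sizes. *)
Lemma perm_exchange A A' X :
  A \subset X -> A' \subset X -> #|A| = #|A'| ->
  exists p : {perm T}, forall x, ((p x \in A) = (x \in A')) /\ ((p x \in X) = (x \in X)).
Proof.
move=> AX AX' eA.
pose l (Y : {set T}) := enum Y ++ (enum (X :\: Y) ++ enum (~: X)).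
have sl (Y : {set T}) : Y \subset X -> size (l Y) = #|T|.
  move=> YX; rewrite !size_cat -!cardE addnA finset.cardsD (finset.setIidPr YX) subnKC ?subset_leq_card //.
  by rewrite finset.cardsC.
have ul (Y : {set T}) : Y \subset X -> uniq (l Y).
  move=> YX; rewrite !cat_uniq !enum_uniq /= !andbT; apply/andP; split.
    apply/hasPn => x; rewrite mem_cat !mem_enum !inE => /orP[/andP[]//|].
    by apply: contra => /(fintype.subsetP YX).
  by apply/hasPn => x; rewrite !mem_enum !inE => /negbTE ->; rewrite andbF.
have sD (Y : {set T}) : Y \subset X -> size (enum (X :\: Y)) = (#|X| - #|Y|)%N.
  by move=> YX; rewrite -cardE finset.cardsD (finset.setIidPr YX).
have [p hp] := perm_of_lists (ul _ AX') (ul _ AX) (sl _ AX') (sl _ AX).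
exists p => x; rewrite hp /l !index_cat !mem_enum.
case: ifP => [xA'|xA'].
  have lt1 : (index x (enum A') < size (enum A))%N.
    by rewrite -cardE eA cardE index_mem mem_enum.
  rewrite nth_cat lt1.
  have : nth x (enum A) (index x (enum A')) \in A by rewrite -mem_enum mem_nth.
  by move=> h; rewrite h (fintype.subsetP AX _ h) (fintype.subsetP AX' _ xA').
have e0 : size (enum A') = size (enum A) by rewrite -!cardE.
rewrite e0 nth_cat ltnNge leq_addr /= addKn.
case: ifP => [xD|xD].
  have xX : x \in X by move: xD; rewrite inE => /andP[].
  have lt1 : (index x (enum (X :\: A')) < size (enum (X :\: A)))%N.
    by rewrite sD // eA -sD // index_mem mem_enum.
  rewrite nth_cat lt1.
  have : nth x (enum (X :\: A)) (index x (enum (X :\: A'))) \in X :\: A.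
    by rewrite -mem_enum mem_nth.
  by rewrite inE => /andP[/negbTE -> ->]; rewrite xX.
have xX : x \notin X by move: xD; rewrite inE xA' /= => ->.
rewrite sD // -eA -sD // nth_cat ltnNge leq_addr /= addKn.
have : nth x (enum (~: X)) (index x (enum (~: X))) = x by rewrite nth_index // mem_enum inE.
move=> ->; split; last by [].
by apply: contraNF xX; apply: fintype.subsetP.
Qed.

(** Composition with a permutation that preserves [X] and carries [A] to [A'] injects the orderings
    with [A'] first into those with [A] first. *)
Lemma before_card_eq A A' X :
  A \subset X -> A' \subset X -> #|A| = #|A'| ->
  (#|[pred p | before p A' (X :\: A')]| <= #|[pred p | before p A (X :\: A)]|)%N.
Proof.
move=> AX AX' eA.
have [r hr] := perm_exchange AX' AX (esym eA).
rewrite -(card_in_imset (f := fun p => (r * p)%g)) => [|p1 p2 _ _ /mulgI //].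
apply: subset_leq_card; apply/fintype.subsetP => _ /imsetP[p + ->].
rewrite !inE => /beforeP h; apply/beforeP => a b aA.
rewrite inE => /andP[bA bX]; rewrite !permM; apply: h.
  by have [-> _] := hr a.
by rewrite inE; have [-> ->] := hr b; rewrite bA.
Qed.

Lemma before_exists p X k : (k <= #|X|)%N ->
  exists A, [/\ A \subset X, #|A| = k & before p A (X :\: A)].
Proof.
move=> kX.
pose le x y := (enum_rank (p x) <= enum_rank (p y))%N.
have le_tr : transitive le by move=> y x z; apply: leq_trans.
have le_tot : total le by move=> x y; apply: leq_total.
pose s := sort le (enum X).
have us : uniq s by rewrite sort_uniq enum_uniq.
have ms x : (x \in s) = (x \in X) by rewrite mem_sort mem_enum.
have ss : size s = #|X| by rewrite size_sort -cardE.
(* The first [k] elements of [X] in the order given by [p]. *)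
exists [set x in take k s]; split.
- by apply/fintype.subsetP => x; rewrite inE => /mem_take; rewrite ms.
- rewrite finset.cardsE; have /card_uniqP -> : uniq (take k s) by rewrite take_uniq.
  by rewrite size_takel // ss.
apply/beforeP => a b; rewrite !inE => aT /andP[bT bX].
have bD : b \in drop k s.
  by move: bX; rewrite -ms -{1}(cat_take_drop k s) mem_cat (negbTE bT).
have : pairwise le s by rewrite -sorted_pairwise // sort_sorted.
rewrite -{1}(cat_take_drop k s) pairwise_cat => /andP[/allrelP/(_ _ _ aT bD) h _].
rewrite ltn_neqAle [X in _ && X]h andbT; apply: contraNneq bT => /val_inj/enum_rank_inj/perm_inj <-.
by [].
Qed.

(** Every ordering puts some [#|A|]-element subset of [X] before the rest of [X], and all these
    subsets come first equally often. *)
Lemma before_card A B : [disjoint A & B] ->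
  (#|{perm T}| <= 'C(#|A| + #|B|, #|A|) * #|[pred p | before p A B]|)%N.
Proof.
move=> dAB; pose X := A :|: B.
have cX : (#|A| + #|B| = #|X|)%N by rewrite finset.cardsU disjoint_setI0 // finset.cards0 subn0.
have eB : B = X :\: A.
  rewrite /X finset.setDUl finset.setDv finset.set0U; apply/esym/finset.setDidPl; by rewrite disjoint_sym.
have AX : A \subset X by apply: finset.subsetUl.
have kX : (#|A| <= #|X|)%N by rewrite -cX leq_addr.
rewrite cX -cards_draws -sum_nat_const.
apply: (@leq_trans (\sum_(A' in [set A' : {set T} | A' \subset X & #|A'| == #|A|])
   #|[pred p | before p A' (X :\: A')]|)); last first.
  apply: leq_sum => A'; rewrite inE => /andP[A'X /eqP e].
  by rewrite eB; apply: before_card_eq.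
rewrite (eq_bigr (fun A' => \sum_(p : {perm T} | before p A' (X :\: A')) 1)%N); last first.
  by move=> A' _; rewrite sum1_card.
rewrite (exchange_big_dep predT) //= -[X in (X <= _)%N]sum1_card; apply: leq_sum => p _.
have [A' [A'X e b]] := before_exists p kX.
by rewrite (bigD1 A') //= inE A'X e eqxx.
Qed.

End Orders.

Section CrossIntersection.
Variables (R : realType) (T : finType) (I : Type) (O : oracle) (c : ocomp I).
Variables (Y : I -> bool) (A B : I -> {set T}) (W : R).
Hypothesis hA : forall i, supp O c i -> Y i ->
  [disjoint A i & B i] /\ ('C(#|A i| + #|B i|, #|A i|)%:R <= W).

(* Bollobas' set-pair inequality in averaged form, by Lubell's permutation
   argument and Cauchy-Schwarz over the orderings. *)
Lemma cross_disjoint_pr :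
  (cex O c (fun i => (Y i)%:R)) ^+ 2 <= 2 * W *
  cex O c (fun i => cex O c (fun j => (Y i && Y j && [disjoint A i & B j])%:R)).
Proof.
set y := cex O c _.
pose P : R := #|{perm T}|%:R.
have P0 : 0 < P by rewrite ltr0n; apply/card_gt0P; exists 1%g.
pose e i : R := #|[pred p : {perm T} | before p (A i) (B i)]|%:R.
have avg_e i : \sum_(p : {perm T}) (before p (A i) (B i))%:R = e i.
  by rewrite /e -sum1_card natr_sum [RHS]big_mkcond /=; apply: eq_bigr => p _; rewrite inE; case: ifP.
have PW i : supp O c i -> Y i -> 0 < e i /\ P / e i <= W.
  move=> si Yi; have [d hW] := hA si Yi.
  have h := before_card d.
  have e0 : 0 < e i.
    rewrite ltr0n lt0n; apply: contraTN h => /eqP ->.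
    by rewrite muln0 -ltnNge -(ltr0n R).
  split=> //; rewrite ler_pdivrMr // (le_trans _ (ler_wpM2r (ltW e0) hW)) //.
  by rewrite -natrM ler_nat.
(* The factor [P / e i] makes the mean over all orderings of the term of [i] equal to the indicator
   of [Y i]. *)
pose f p : R := cex O c (fun i => (Y i && before p (A i) (B i))%:R * (P / e i)).
have sf : \sum_p f p = P * y.
  rewrite -cex_sum -cexZ; apply: cex_eq_supp => i si.
  rewrite -mulr_suml; case: (boolP (Y i)) => /= Yi; last by rewrite big1_eq mul0r mulr0.
  have [e0 _] := PW i si Yi.
  by rewrite avg_e mulr1 mulrC divfK // gt_eqF.
(* Both [i] and [j] contribute for the same [p] only if one of the crossing pairs is disjoint, and
   then the sum over [p] is at most [P * W]. *)
have sf2 : \sum_p f p ^+ 2 <= P * (W * (2 *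
    cex O c (fun i => cex O c (fun j => (Y i && Y j && [disjoint A i & B j])%:R)))).
  pose D i j : R := (Y i && Y j && [disjoint A i & B j])%:R.
  have -> : 2 * cex O c (fun i => cex O c (fun j => D i j)) =
     cex O c (fun i => cex O c (fun j => D i j + D j i)).
    rewrite [RHS](cex_eq _ _ (G := fun i => cex O c (D i) + cex O c (fun j => D j i))); last first.
      by move=> i; apply: (cexD O c (D i) (fun j => D j i)).
    by rewrite cexD -(cex_exchange _ _ _ D) mulr2n mulrDl mul1r.
  have -> : \sum_p f p ^+ 2 = cex O c (fun i => cex O c (fun j =>
      \sum_p ((Y i && before p (A i) (B i))%:R * (P / e i)) *
             ((Y j && before p (A j) (B j))%:R * (P / e j)))).
    rewrite [RHS](cex_eq _ _ (G := fun i => \sum_p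
       ((Y i && before p (A i) (B i))%:R * (P / e i)) * f p)); last first.
      by move=> i; rewrite cex_sum; apply: eq_bigr => p _; rewrite cexZ.
    rewrite cex_sum; apply: eq_bigr => p _; rewrite expr2 -cexZ.
    by apply: cex_eq => i; rewrite mulrC.
  rewrite -!cexZ; apply: cex_le_supp => i si; rewrite -!cexZ; apply: cex_le_supp => j sj.
  rewrite /D; case: (boolP (Y i)) => Yi; last first.
    by rewrite big1 /= ?andbF /= ?addr0 ?mulr0 // => p _; rewrite !mul0r.
  case: (boolP (Y j)) => Yj; last first.
    by rewrite big1 /= ?addr0 ?mulr0 // => p _; rewrite !mul0r mulr0.
  have [ei0 Wi] := PW i si Yi; have [ej0 Wj] := PW j sj Yj.
  rewrite /=.
  have W0 : 0 <= W by apply: le_trans Wi; rewrite divr_ge0 ?ltW.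
  case: (boolP ([disjoint A i & B j] || [disjoint A j & B i])) => dd; last first.
    rewrite big1; first by apply: mulr_ge0; [exact: ltW|rewrite mulr_ge0 // addr_ge0].
    move=> p _; case: (boolP (before p (A i) (B i))) => bi; last by rewrite !mul0r.
    case: (boolP (before p (A j) (B j))) => bj; last by rewrite mul0r mulr0.
    by rewrite (before_cross bi bj) in dd.
  apply: (@le_trans _ _ (P * W)); last first.
    rewrite ler_pM2l // ler_peMr //.
    by case/orP: dd => ->; rewrite ?lerDl ?lerDr ?ler0n.
  have -> : P * W = (e i * (P / e i)) * W by rewrite mulrC (mulrC (e i)) divfK ?gt_eqF // mulrC.
  rewrite -[X in _ <= X * _ * _]avg_e mulr_suml mulr_suml; apply: ler_sum => p _.
  case: (before p (A i) (B i)); rewrite ?mul0r // !mul1r.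
  rewrite ler_pM2l ?divr_gt0 //; apply: (le_trans _ Wj).
  by apply: ler_piMl; [rewrite divr_ge0 ?ltW|rewrite lern1 leq_b1].
(* Cauchy-Schwarz, from the nonnegative sum of squared deviations from the mean [m]. *)
have cs : (\sum_p f p) ^+ 2 <= P * \sum_p f p ^+ 2.
  pose m := (\sum_p f p) / P.
  have : 0 <= \sum_p (f p - m) ^+ 2 by apply: sumr_ge0 => p _; rewrite sqr_ge0.
  have -> : \sum_p (f p - m) ^+ 2 = \sum_p f p ^+ 2 - (\sum_p f p) ^+ 2 / P.
    rewrite (eq_bigr (fun p => f p ^+ 2 + (- (2 * m) * f p + m ^+ 2))); last first.
      by move=> p _; ring.
    rewrite !big_split /= -mulr_sumr sumr_const -[_ *+ _]mulr_natr -/P /m.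
    by field; rewrite gt_eqF.
  by rewrite subr_ge0 ler_pdivrMr // mulrC.
have := le_trans cs (ler_wpM2l (ltW P0) sf2).
rewrite sf exprMn expr2 -!mulrA !ler_pM2l // => h; apply: le_trans h _.
by rewrite mulrCA.
Qed.

End CrossIntersection.

(** * Rounds of the attack *)

(* A run whose coins are the successive digits of [i] in a mixed radix. *)
Fixpoint run (A : Type) (O : oracle) (c : ocomp A) (i : nat) : A * seq query :=
  match c with
  | Ret a => (a, [::])
  | Ask l x k => let p := run O (k (O l x)) i in (p.1, qry x :: p.2)
  | Rand m k => run O (k (inord (i %% m.+1))) (i %/ m.+1)
  end.

(** If [i] is uniform below a multiple of [den c], the digits read by [run] are exactly uniform
    coins. The product over all answers at [Ask] makes this valid for every oracle. *)
Fixpoint den (A : Type) (c : ocomp A) : nat :=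
  match c with
  | Ret _ => 1
  | Ask l x k => \prod_y den (k y)
  | Rand m k => m.+1 * \prod_i den (k i)
  end.

Section Run.
Variable R : realType.

Lemma den_gt0 A (c : ocomp A) : (0 < den c)%N.
Proof.
elim: c => [a|l x k IH|m k IH] //=; first by apply: prodn_gt0.
by rewrite muln_gt0 /=; apply: prodn_gt0.
Qed.

Lemma sum_digits (F : nat -> R) (a b : nat) :
  \sum_(i < a * b) F i = \sum_(r < a) \sum_(j < b) F (j * a + r)%N.
Proof.
elim: b => [|b IH].
  by rewrite muln0 big_ord0 big1 // => r _; rewrite big_ord0.
rewrite mulnS addnC big_split_ord /= IH -big_split /=; apply: eq_bigr => r _.
by rewrite big_ord_recr /= mulnC.
Qed.

Lemma sum_run A O (c : ocomp A) (M : nat) (F : A * seq query -> R) :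
  (den c %| M)%N -> \sum_(i < M) F (run O c i) = M%:R * cex O (trace c) F.
Proof.
elim: c M F => [a|l x k IH|m k IH] M F /=.
- by move=> _; rewrite sumr_const card_ord mulr_natl.
- move=> h; rewrite (IH (O l x) M (fun p => F (p.1, qry x :: p.2))) ?cex_obind //.
  by apply: dvdn_trans h; rewrite (bigD1 (O l x)) //= dvdn_mulr.
- move=> /dvdnP[d ->]; set p := (\prod_i _)%N.
  rewrite mulnCA (sum_digits (fun i => F (run O (k (inord (i %% m.+1))) (i %/ m.+1)))).
  rewrite natrM [RHS](_ : _ = (d * p)%:R * \sum_(i < m.+1) cex O (trace (k i)) F); last first.
    by field; rewrite addrC natr1 pnatr_eq0.
  rewrite mulr_sumr; apply: eq_bigr => r _; rewrite -IH.
    apply: eq_bigr => j _; congr (F _).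
    by rewrite modnMDl divnMDl // modn_small // divn_small // addn0 inord_val.
  by rewrite /p (bigD1 r) //= dvdn_mull // dvdn_mulr.
Qed.

Lemma run_agree A O1 O2 (c : ocomp A) i :
  {in (run O2 c i).2, answer O1 =1 answer O2} -> run O1 c i = run O2 c i.
Proof.
elim: c i => [a|l x k IH|m k IH] i //=; last exact: IH.
move=> h.
have e : O1 l x = O2 l x.
  have := h (qry x); rewrite inE eqxx => /(_ isT) /eqP.
  by rewrite eq_Tagged => /eqP.
by rewrite e IH // => y hy; apply: h; rewrite inE hy orbT.
Qed.

End Run.

Lemma answer_eq O O' l (x : l.-tuple bool) :
  answer O (qry x) = answer O' (qry x) -> O l x = O' l x.
Proof. by move/eqP; rewrite eq_Tagged => /eqP. Qed.

Lemma answer_mix Q O' O x : answer (mixO Q O' O) x = if x \in Q then answer O' x else answer O x.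
Proof. by case: x => l x; rewrite /answer /mixO /=; case: ifP => //; rewrite -/(qry x) => ->. Qed.

Section Swap.
Variable L : nat.

Definition foracle_mix (Q : seq query) (f' f : foracle L) : foracle L :=
  [ffun l : 'I_L => [ffun x : l.-tuple bool => if qry x \in Q then f' l x else f l x]].

Lemma extend_mix Q (f' f : foracle L) l (x : l.-tuple bool) :
  extend (foracle_mix Q f' f) x = mixO Q (extend f') (extend f) x.
Proof.
rewrite /mixO /extend; case: decP => [lL|_]; last by rewrite if_same.
by rewrite !ffunE.
Qed.

Lemma answer_foracle_mix Q (f' f : foracle L) x :
  answer (extend (foracle_mix Q f' f)) x =
  if x \in Q then answer (extend f') x else answer (extend f) x.
Proof. by rewrite -answer_mix; case: x => l x; rewrite /answer /= extend_mix. Qed.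

End Swap.

(** * The rounds for abstract signing, searching and checking *)

Section Rounds.
Variables (R : realType) (L M : nat) (B Z U : Type) (V : eqType).
(** [c0] generates the keys and signs the first message, and [vis] extracts what the adversary sees.
    [srch] looks for a candidate forgery, [chk] tests it, [fin] is its real verification, and [lrn]
    performs the initial verifications. *)
Variables (c0 : ocomp B) (vis : B -> V).
Variables (srch : B -> seq query -> seq query -> ocomp Z).
Variables (chk : V -> seq query -> seq query -> Z -> ocomp bool).
Variables (fin : V -> Z -> ocomp bool) (lrn : V -> ocomp U).

(** The coins of [c0] are encoded by one number, so that worlds form a finite type and can be drawn
    uniformly from a list. *)
Definition world : finType := (foracle L * 'I_M.+1)%type.
Implicit Types w : world.

Definition ov w : oracle := extend w.1.
Definition out w := run (ov w) c0 w.2.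
Definition vs w := vis (out w).1.
Definition rd w K0 : ocomp bool :=
  obind (srch (out w).1 (out w).2 K0) (chk (vs w) (out w).2 K0).

Definition consistent (v : V) (kn : seq (query * query)) : seq world :=
  [seq w <- enum {: world} | (vs w == v) && all (fun e => answer (ov w) e.1 == e.2) kn].

Definition world0 : world := ([ffun l => [ffun x => x]], ord0).

(** The first [r] rounds serve only for the genuine query-answer pairs they reveal; the last draw
    returns its candidate. Search and check keep using the initial [K0], so every round is compared
    with the same ideal experiment. *)
Fixpoint rounds (v : V) K0 (r : nat) (kn : seq (query * query)) : ocomp Z :=
  obind (unif world0 (consistent v kn)) (fun w =>
  if r is r'.+1 then
    obind (patched (out w).2 (ov w) (rd w K0)) (fun p => rounds v K0 r' (p.2 ++ kn))
  else obind (patched (out w).2 (ov w) (srch (out w).1 (out w).2 K0)) (fun p => Ret p.1)).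

(** [round0] and [roundS] name the two unfoldings of [rounds], to which it is converted before
    rewriting. *)
Definition round0 v K0 kn : ocomp Z :=
  obind (unif world0 (consistent v kn)) (fun w =>
    obind (patched (out w).2 (ov w) (srch (out w).1 (out w).2 K0)) (fun p => Ret p.1)).

Definition roundS v K0 r kn : ocomp Z :=
  obind (unif world0 (consistent v kn)) (fun w =>
    obind (patched (out w).2 (ov w) (rd w K0)) (fun p => rounds v K0 r (p.2 ++ kn))).

Definition ann w (K : seq query) := [seq (x, answer (ov w) x) | x <- K].

(** The worlds that the adversary cannot tell from [w] when it knows the answers on [K]. *)
Definition cl w K : pred world := fun w' =>
  (vs w' == vs w) && all (fun x => answer (ov w') x == answer (ov w) x) K.

Definition avg (P : pred world) (F : world -> R) : R := (\sum_(w | P w) F w) / #|P|%:R.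

Lemma cl_refl w K : cl w K w.
Proof. by rewrite /cl eqxx; apply/allP => x _ /=. Qed.

Lemma cl_eq w w' K : cl w K w' -> cl w' K =1 cl w K.
Proof.
move=> /andP[/eqP e /allP h] w''; rewrite /cl e; congr (_ && _).
by apply: eq_in_all => x /h /eqP ->.
Qed.

Lemma cex_consistent w K (F : world -> R) O :
  cex O (unif world0 (consistent (vs w) (ann w K))) F = avg (cl w K) F.
Proof.
have e : consistent (vs w) (ann w K) = [seq w' <- enum {: world} | cl w K w'].
  by apply: eq_filter => w'; rewrite /cl /ann all_map.
rewrite e cex_unif.
  rewrite big_filter [X in X / _]big_enum_cond /avg /=; congr (_ / _%:R).
  by rewrite cardE /enum_mem -enumT -filter_predI; congr size; apply: eq_filter => w'; rewrite /= !inE andbT.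
rewrite size_filter -has_count; apply/hasP; exists w; first by rewrite mem_enum.
exact: cl_refl.
Qed.

(** Success probability in the real world [w] when [r] rounds precede the candidate and the answers
    on [K] are known. *)
Definition val w K0 r K : R :=
  cex (ov w) (rounds (vs w) K0 r (ann w K)) (fun z => coin_pr R (ov w) (fin (vs w) z) id).

Definition hit w (K : seq query) : pred (seq query) := has (fun x => (x \in (out w).2) && (x \notin K)).

(** Probability that, after [r] further rounds, the next round asks a query of the real transcript
    that is still unknown at that time. *)
Fixpoint bad w K0 r K : R :=
  avg (cl w K) (fun w' =>
    if r is r'.+1 then
      cex (mixO (out w').2 (ov w') (ov w)) (trace (rd w' K0))
        (fun p => bad w K0 r' (p.2 ++ K))
    else cex (mixO (out w').2 (ov w') (ov w)) (trace (rd w' K0)) (fun p => (hit w K p.2)%:R)).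

(** The round in which the fake world is the real one, so that both messages are signed honestly
    under the same keys and oracle. *)
Definition ideal w K0 : R := coin_pr R (ov w) (rd w K0) id.

Lemma val0 w K0 K : val w K0 0 K = avg (cl w K) (fun w' =>
  cex (mixO (out w').2 (ov w') (ov w)) (srch (out w').1 (out w').2 K0)
    (fun z => coin_pr R (ov w) (fin (vs w) z) id)).
Proof.
rewrite /val [rounds _ _ _ _](_ : _ = round0 (vs w) K0 (ann w K)) // cex_obind cex_consistent /avg; congr (_ / _); apply: eq_bigr => w' _.
by rewrite /= cex_obind cex_patch /= (cex_trace _ _ (fun z => coin_pr R (ov w) (fin (vs w) z) id)).
Qed.

Lemma valS w K0 r K : val w K0 r.+1 K = avg (cl w K) (fun w' =>
  cex (mixO (out w').2 (ov w') (ov w)) (trace (rd w' K0)) (fun p => val w K0 r (p.2 ++ K))).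
Proof.
rewrite /val [rounds _ _ _ _](_ : _ = roundS (vs w) K0 r (ann w K)) // cex_obind cex_consistent /avg; congr (_ / _); apply: eq_bigr => w' _.
by rewrite /= cex_obind cex_patch /=; apply: cex_eq => p; rewrite /ann map_cat.
Qed.

Lemma avg_ge (P : pred world) w0 (F : world -> R) c :
  P w0 -> (forall w, P w -> F w <= c) -> avg P F <= c.
Proof.
move=> Pw h; have c0' : (0 < #|P|)%N by apply/card_gt0P; exists w0.
rewrite /avg ler_pdivrMr ?ltr0n //.
apply: (le_trans (ler_sum _ h)); rewrite sumr_const mulr_natr lexx //.
Qed.

(* Every bad round makes one more query of [out w] known. *)
Lemma bad_sum w K0 r K :
  \sum_(i < r) bad w K0 i K <= (count (fun x => x \notin K) (out w).2)%:R.
Proof.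
elim: r K => [|r IH] K; first by rewrite big_ord0.
rewrite big_ord_recl /=.
rewrite /avg -mulr_suml exchange_big -mulrDl -big_split /=.
apply: (@avg_ge _ w _ _ (cl_refl w K)) => w' _.
rewrite -cex_sum -cexD -[leRHS](cex_const (mixO (out w').2 (ov w') (ov w)) (trace (rd w' K0))).
apply: cex_le => p; apply: le_trans (lerD (lexx _) (IH _)) _.
rewrite -natrD ler_nat; case: (boolP (hit w K p.2)) => h; last first.
  by rewrite add0n; apply: sub_count => x; rewrite mem_cat negb_or => /andP[].
have [x xp /andP[xQ xK]] := hasP h.
have -> : (1 + count (fun x => x \notin p.2 ++ K) (out w).2 <= count (fun x => x \notin K) (out w).2)%N.
  pose a2 := [pred x : query | (x \in p.2) && (x \notin K)].
  have h2 : (0 < count a2 (out w).2)%N by rewrite -has_count; apply/hasP; exists x; rewrite //= xp.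
  rewrite addnC (@leq_trans (count (fun x => x \notin p.2 ++ K) (out w).2 + count a2 (out w).2)) ?leq_add2l //.
  have e y : (y \notin p.2 ++ K) = (y \notin p.2) && (y \notin K) by rewrite mem_cat negb_or.
  rewrite -count_predUI [X in (_ + X)%N](eq_count (a2 := pred0)).
    rewrite count_pred0 addn0; apply: sub_count => y /orP[h'|/andP[] //].
    by have /andP[] : (y \notin p.2) && (y \notin K) by rewrite -e.
  move=> y; apply/negbTE/negP => /andP[h' /andP[yp _]].
  have /andP[h'' _] : (y \notin p.2) && (y \notin K) by rewrite -e.
  by move/negP: h''; apply.
by [].
Qed.


Lemma out_mix w f Q : {subset (out w).2 <= Q} -> out (foracle_mix Q w.1 f, w.2) = out w.
Proof.
move=> QQ; rewrite /out /=; apply: run_agree => x hx; rewrite /ov answer_foracle_mix.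
by rewrite QQ.
Qed.

(** The exchange outside both transcripts leaves the transcripts unchanged, so it is an involution.
    The oracle of the second component then differs from the hybrid one only on queries of the first
    transcript. *)
Definition swap (p : world * world) : world * world :=
  let Q := (out p.1).2 ++ (out p.2).2 in
  ((foracle_mix Q p.1.1 p.2.1, p.1.2), (foracle_mix Q p.2.1 p.1.1, p.2.2)).

Lemma out_swap1 p : out (swap p).1 = out p.1.
Proof. by apply: out_mix => x hx; rewrite mem_cat hx. Qed.

Lemma out_swap2 p : out (swap p).2 = out p.2.
Proof. by apply: out_mix => x hx; rewrite mem_cat hx orbT. Qed.

Lemma foracle_mixK Q (f f' : foracle L) :
  foracle_mix Q (foracle_mix Q f f') (foracle_mix Q f' f) = f.
Proof.
by apply/ffunP => l; apply/ffunP => x; rewrite !ffunE; case: ifP => h; rewrite h.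
Qed.

Lemma swapK : involutive swap.
Proof.
move=> p; rewrite {1}/swap out_swap1 out_swap2 /= !foracle_mixK.
by case: p => -[? ?] [? ?].
Qed.

Lemma cl_swap w K p : cl w K p.1 && cl w K p.2 -> cl w K (swap p).1 && cl w K (swap p).2.
Proof.
rewrite /cl /vs out_swap1 out_swap2 => /andP[/andP[-> h1] /andP[-> h2]] /=.
by apply/andP; split; apply/allP => x xK; rewrite /ov answer_foracle_mix;
  case: ifP => _; rewrite ?(allP h1 _ xK) ?(allP h2 _ xK).
Qed.

(** The worlds are split by the answers that [c] receives. At each leaf there remains a class of
    worlds that agree on the queries asked, so nonnegativity is needed only for such classes and a
    fixed outcome. *)
Lemma chain (C : pred world) Q' O' A (c : ocomp A) (G : world -> A * seq query -> R) :
  (forall w0, C w0 -> forall a qs,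
     0 <= \sum_(w | C w && all (fun x => answer (ov w) x == answer (ov w0) x) qs) G w (a, qs)) ->
  0 <= \sum_(w | C w) cex (mixO Q' O' (ov w)) (trace c) (G w).
Proof.
elim: c C G => [a|l x k IH|m k IH] C G H /=.
- have [w0 Cw0|C0] := pickP C; last by rewrite big_pred0.
  have := H w0 Cw0 a [::]; rewrite /= (eq_bigl C) // => w; exact: andbT.
- rewrite (partition_big (fun w => ov w x) predT) //=; apply: sumr_ge0 => y _.
  pose z := if qry x \in Q' then O' l x else y.
  rewrite (eq_bigr (fun w => cex (mixO Q' O' (ov w)) (trace (k z))
     (fun p => G w (p.1, qry x :: p.2)))); last first.
    by move=> w /andP[_ /eqP e]; rewrite cex_obind /= /z -e.
  apply: (IH z (fun w => C w && (ov w x == y)) (fun w p => G w (p.1, qry x :: p.2))).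
  move=> w0 /andP[Cw0 /eqP e0] a qs.
  have := H w0 Cw0 a (qry x :: qs); rewrite (eq_bigl (fun w =>
    (C w && (ov w x == y)) && all (fun x => answer (ov w) x == answer (ov w0) x) qs)) //.
  by move=> w; rewrite /= andbA eq_Tagged /= e0.
- rewrite -mulr_suml mulr_ge0 ?invr_ge0 ?ler0n // exchange_big /=.
  by apply: sumr_ge0 => i _; apply: IH.
Qed.

Hypothesis hchk : forall v Q (K0 : seq query) z O O',
  (forall l (x : l.-tuple bool), ~~ ((qry x \in Q) && (qry x \notin K0)) -> O l x = O' l x) ->
  coin_pr R O' (chk v Q K0 z) id <= coin_pr R O (fin v z) id.

(** The oracle of the second swapped world and the hybrid one differ only on unknown queries of the
    real transcript, at the cost of a hit. The hybrid and the real oracle differ only on unknown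
    fake queries, a difference covered by [hchk]. *)
Lemma ideal_swap w0 w w' K0 K :
  {subset K0 <= K} -> cl w0 K w -> cl w0 K w' ->
  ideal (swap (w, w')).2 K0 <=
  cex (mixO (out w').2 (ov w') (ov w)) (srch (out w').1 (out w').2 K0)
    (fun z => coin_pr R (ov w) (fin (vs w) z) id) +
  cex (mixO (out w').2 (ov w') (ov w)) (trace (rd w' K0)) (fun p => (hit w K p.2)%:R).
Proof.
move=> KK hw hw'; set Oh := mixO _ _ _.
have agree x : x \in K -> answer (ov w') x = answer (ov w) x.
  move=> xK; have /andP[_ /allP/(_ _ xK)/eqP ->] := hw.
  by have /andP[_ /allP/(_ _ xK)/eqP ->] := hw'.
have -> : ideal (swap (w, w')).2 K0 =
    coin_pr R (ov (swap (w, w')).2) (trace (rd w' K0)) (fun p => p.1).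
  rewrite /ideal /rd /vs out_swap2 /= !coin_prE.
  by rewrite (cex_trace _ _ (fun b : bool => b%:R)).
apply: (le_trans (@coin_pr_until R bool Oh _ _
  (fun x => (x \in (out w).2) && (x \notin K)) (fun p => p.1) _)).
  move=> l x; rewrite negb_and negbK => h; apply: answer_eq.
  rewrite answer_mix /ov /= answer_foracle_mix mem_cat.
  case: (boolP (qry x \in (out w').2)) => xQ'; first by rewrite orbT.
  rewrite orbF; case: ifP => // xQ; move: h; rewrite xQ /=.
  by move=> /agree.
have : cex Oh (srch (out w').1 (out w').2 K0) (fun z => coin_pr R (ov w) (fin (vs w) z) id)
  + cex Oh (trace (rd w' K0)) (fun p => (hit w K p.2)%:R) >=
  cex Oh (trace (rd w' K0)) (fun p => (p.1 : bool)%:R + (hit w K p.2)%:R).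
  rewrite cexD lerD2r (cex_trace _ _ (fun b : bool => b%:R)) /rd cex_obind.
  apply: cex_le => z; rewrite -(coin_prE _ _ _ id).
  have -> : vs w = vs w' by have /andP[/eqP -> _] := hw; have /andP[/eqP -> _] := hw'.
  apply: hchk => l x; rewrite negb_and negbK => h; apply: answer_eq.
  by rewrite answer_mix; case: ifP h => //= _ /KK /agree ->.
apply: le_trans; rewrite coin_prE; apply: cex_le => p.
by rewrite -natrD ler_nat /hit; case: p.1; case: has.
Qed.

(** For [r = 0] the swap permutes the pairs of worlds in the class, so the ideal value of the
    swapped fake world has the same sum as that of the real world. A further round splits the class
    by its answers, and the induction hypothesis applies to each part. *)
Lemma val_ge w0 K0 r K : {subset K0 <= K} ->
  0 <= \sum_(w | cl w0 K w) (val w K0 r K - ideal w K0 + bad w K0 r K).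
Proof.
elim: r w0 K => [|r IH] w0 K KK.
  have C0 : (0 < #|cl w0 K|)%N by apply/card_gt0P; exists w0; apply: cl_refl.
  rewrite (eq_bigr (fun w => (\sum_(w' | cl w0 K w')
    (cex (mixO (out w').2 (ov w') (ov w)) (srch (out w').1 (out w').2 K0)
       (fun z => coin_pr R (ov w) (fin (vs w) z) id) +
     cex (mixO (out w').2 (ov w') (ov w)) (trace (rd w' K0)) (fun p => (hit w K p.2)%:R)
     - ideal w K0)) / #|cl w0 K|%:R)); last first.
    move=> w hw; rewrite val0 /= /avg (eq_card (cl_eq hw)) !(eq_bigl _ _ (cl_eq hw)).
    rewrite sumrB big_split /= sumr_const -[ideal w K0 *+ _]mulr_natr.
    by field; rewrite pnatr_eq0 -lt0n.
  rewrite -mulr_suml mulr_ge0 ?invr_ge0 ?ler0n //.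
  under eq_bigr do rewrite sumrB.
  rewrite sumrB subr_ge0.
  rewrite [leLHS](_ : _ = \sum_(w | cl w0 K w) \sum_(w' | cl w0 K w') ideal (swap (w, w')).2 K0).
    by apply: ler_sum => w hw; apply: ler_sum => w' hw'; exact: (ideal_swap KK hw hw').
  rewrite [RHS](pair_big (cl w0 K) (cl w0 K) (fun w w' => ideal (swap (w, w')).2 K0)) /=.
  rewrite [RHS](reindex_inj (inv_inj swapK)) /= [LHS]exchange_big /=.
  rewrite [LHS](pair_big (cl w0 K) (cl w0 K) (fun w w' => ideal w' K0)) /=.
  apply: eq_big => p; last by move=> _; rewrite -{1}(swapK p).
  by apply/idP/idP => h; [apply: cl_swap|rewrite -(swapK p); apply: cl_swap].
have C0 : (0 < #|cl w0 K|)%N by apply/card_gt0P; exists w0; apply: cl_refl.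
rewrite (eq_bigr (fun w => (\sum_(w' | cl w0 K w')
    (cex (mixO (out w').2 (ov w') (ov w)) (trace (rd w' K0))
      (fun p => val w K0 r (p.2 ++ K) - ideal w K0 + bad w K0 r (p.2 ++ K)))) / #|cl w0 K|%:R)); last first.
  move=> w hw; rewrite valS /= /avg (eq_card (cl_eq hw)) !(eq_bigl _ _ (cl_eq hw)).
  rewrite [in RHS](eq_bigr (fun w' =>
     cex (mixO (out w').2 (ov w') (ov w)) (trace (rd w' K0)) (fun p => val w K0 r (p.2 ++ K))
     + cex (mixO (out w').2 (ov w') (ov w)) (trace (rd w' K0)) (fun p => bad w K0 r (p.2 ++ K))
     - ideal w K0)); last first.
    move=> w' _; rewrite -cexD -[in RHS](cex_const (mixO (out w').2 (ov w') (ov w)) (trace (rd w' K0)) (ideal w K0)).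
    by rewrite -cexB; apply: cex_eq => p; rewrite addrAC.
  rewrite sumrB big_split /= sumr_const -[ideal w K0 *+ _]mulr_natr.
  by field; rewrite pnatr_eq0 -lt0n.
rewrite -mulr_suml mulr_ge0 ?invr_ge0 ?ler0n // exchange_big; apply: sumr_ge0 => w' hw' /=.
apply: (@chain (cl w0 K) _ _ _ _ (fun w p => val w K0 r (p.2 ++ K) - ideal w K0 + bad w K0 r (p.2 ++ K))).
move=> w1 hw1 a qs; rewrite /= (eq_bigl (cl w1 (qs ++ K))).
  by apply: IH => x /KK; rewrite mem_cat => ->; rewrite orbT.
move=> w; rewrite -(cl_eq hw1) /cl all_cat -andbA; congr (_ && _); exact: andbC.
Qed.

(** Patching with the empty set changes no answer and merely records the genuine pairs. The number
    of rounds before the candidate is random, so that it rarely falls on one of the few bad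
    rounds. *)
Definition forge0 (v : V) (T : nat) : ocomp Z :=
  obind (patched [::] (ov world0) (lrn v)) (fun p =>
  obind (unif 0%N (iota 0 T)) (fun r => rounds v [seq e.1 | e <- p.2] r p.2)).

(** As [V] is an arbitrary [eqType], the classes are indexed by the representative that [pick]
    returns. *)
Lemma sum_classes (G : world -> R) :
  (forall w0, 0 <= \sum_(w | vs w == vs w0) G w) -> 0 <= \sum_w G w.
Proof.
move=> H; rewrite (partition_big (fun w => [pick w' | vs w' == vs w]) predT) //=.
apply: sumr_ge0 => -[w0|] _; last first.
  rewrite big1 // => w; case: pickP => // /(_ w); by rewrite eqxx.
have [w1 e1|no] := pickP [pred w | [pick w' | vs w' == vs w] == Some w0]; last first.
  by rewrite big_pred0 // => w; have := no w; rewrite /= andTb.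
rewrite (eq_bigl (fun w => vs w == vs w0)) // => w /=.
have p0 : vs w0 = vs w1 by move: e1 => /=; case: pickP => // w2 /eqP h /eqP [<-].
apply/idP/idP => [|/eqP e]; last by rewrite e p0.
by case: pickP => // w2 /eqP h /eqP [<-]; rewrite h.
Qed.

(** Averaging over the [T] possible numbers of rounds turns an expected total of at most [q] bad
    rounds into the loss [q / T]. *)
Lemma forge_ge (T q : nat) : (0 < T)%N -> (forall w, size (out w).2 <= q)%N ->
  \sum_w (cex (ov w) (trace (lrn (vs w))) (fun p => ideal w p.2) - q%:R / T%:R) <=
  \sum_w cex (ov w) (forge0 (vs w) T) (fun z => coin_pr R (ov w) (fin (vs w) z) id).
Proof.
move=> T0 hq; rewrite -subr_ge0 -sumrB.
have T0' : 0 < T%:R :> R by rewrite ltr0n.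
pose G w (K : seq query) := T%:R^-1 * \sum_(r < T) (val w K r K - ideal w K + bad w K r K).
apply: (@le_trans _ _ (\sum_w cex (ov w) (trace (lrn (vs w))) (fun p => G w p.2))); last first.
  apply: ler_sum => w _.
  have -> : cex (ov w) (forge0 (vs w) T) (fun z => coin_pr R (ov w) (fin (vs w) z) id) =
    cex (ov w) (trace (lrn (vs w))) (fun p => T%:R^-1 * \sum_(r < T) val w p.2 r p.2).
    rewrite /forge0 cex_obind cex_patch.
    rewrite (@cex_ext _ _ _ (ov w)); last by move=> l x; rewrite /mixO in_nil.
    apply: cex_eq => p; rewrite cex_obind cex_unif ?size_iota // mulrC; congr (_ * _).
    rewrite -{1}[T]subn0 -/(index_iota 0 T) big_mkord; apply: eq_bigr => r _.
    by rewrite /val /ann -map_comp map_id.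
  rewrite opprB addrA -(cex_const (ov w) (trace (lrn (vs w))) (q%:R / T%:R)) -cexD -cexB.
  apply: cex_le => p; rewrite /G big_split /= sumrB sumr_const card_ord.
  rewrite -[ideal _ _ *+ _]mulr_natr mulrDr mulrBr.
  have -> : T%:R^-1 * (ideal w p.2 * T%:R) = ideal w p.2 by field; rewrite gt_eqF.
  rewrite addrAC lerD2r lerD2l mulrC ler_pM2r ?invr_gt0 //.
  apply: le_trans (bad_sum _ _ _ _) _; rewrite ler_nat.
  by apply: leq_trans (count_size _ _) (hq w).
apply: sum_classes => w0.
rewrite (eq_bigr (fun w => cex (mixO [::] (ov w0) (ov w)) (trace (lrn (vs w0))) (fun p => G w p.2))); last first.
  move=> w /eqP ->; apply: cex_ext => l x; by rewrite /mixO in_nil.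
apply: (@chain (fun w => vs w == vs w0) _ _ _ _ (fun w p => G w p.2)).
move=> w1 /eqP hw1 a qs; rewrite /G -mulr_sumr mulr_ge0 ?invr_ge0 ?ler0n // exchange_big /=.
apply: sumr_ge0 => r _; rewrite (eq_bigl (cl w1 qs)); first exact: val_ge.
by move=> w; rewrite /cl hw1.
Qed.

End Rounds.

(** * The adversary *)

Lemma obindA A B C (c : ocomp A) (f : A -> ocomp B) (g : B -> ocomp C) :
  obind (obind c f) g = obind c (fun x => obind (f x) g).
Proof.
by elim: c => [a|l x k IH|m k IH] //=; congr (_ _); apply/funext => y.
Qed.

Lemma run_supp A O (c : ocomp A) i : supp O (trace c) (run O c i).
Proof.
elim: c i => [a|l x k IH|m k IH] i //=; last by eexists; apply: IH.
by apply/supp_obind; exists (run O (k (O l x)) i).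
Qed.

Fixpoint reps (A : Type) (t : nat) (c : ocomp A) : ocomp (seq A) :=
  if t is t'.+1 then obind c (fun a => obind (reps t' c) (fun s => Ret (a :: s)))
  else Ret [::].

Section Attack.
Variables (R : realType) (n : nat) (S : sigScheme n) (q L : nat).

(* [nt0] verifications of the given signature are run at the start, and each
   candidate forgery is subjected to [nt] test verifications. *)
Variables (nt0 nt : nat) (a0 : n.-tuple bool).
Local Notation msg := (n.-tuple bool).

Definition keysig : ocomp (bitseq * bitseq * bitseq) :=
  obind (gen S) (fun k => obind (sign S k.1 a0) (fun s => Ret (k, s))).

Definition visible (b : bitseq * bitseq * bitseq) : bitseq * bitseq := (b.1.2, b.2).

Definition verc vk m s : ocomp (option bool) := cap q L (ver S vk m s).

Definition learn (v : bitseq * bitseq) : ocomp (seq (option bool)) :=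
  reps nt0 (verc v.1 a0 v.2).

(* The queries in [Q] whose answers are known to be genuine are those in [K]. *)
Definition safe (Q K : seq query) (x : query) := (x \notin Q) || (x \in K).

Definition msgs : seq msg := enum {: msg}.

Fixpoint search (k : nat) (b : bitseq * bitseq * bitseq) (Q K : seq query) :
    ocomp (option (msg * bitseq)) :=
  if k is k'.+1 then
    obind (unif a0 msgs) (fun m =>
    obind (cap q L (sign S b.1.1 m)) (fun os =>
    if os is Some s then
      obind (trace (reps nt (verc b.1.2 m s))) (fun p =>
      if (m != a0) && all (safe Q K) p.2 then Ret (Some (m, s))
      else search k' b Q K)
    else search k' b Q K))
  else Ret None.

(** The default [(a0, [::])] always loses, since [a0] is the signed message. A candidate whose
    verification could ask queries of length [L] or more is withheld, so that the game depends only
    on the oracle at lengths below [L]. *)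
Definition outp (vk : bitseq) (z : option (msg * bitseq)) : msg * bitseq :=
  if z is Some ms then
    if (qlen (ver S vk ms.1 ms.2) <= L)%N then ms else (a0, [::])
  else (a0, [::]).

Definition fin (v : bitseq * bitseq) (z : option (msg * bitseq)) : ocomp bool :=
  let ms := outp v.1 z in
  if ms.1 == a0 then Ret false else ver S v.1 ms.1 ms.2.

Definition chk (v : bitseq * bitseq) (Q K : seq query) (z : option (msg * bitseq)) :
    ocomp bool :=
  let ms := outp v.1 z in
  if ms.1 == a0 then Ret false else
  obind (trace (verc v.1 ms.1 ms.2)) (fun p =>
    Ret ((p.1 == Some true) && all (safe Q K) p.2)).

(** When [chk] accepts, its verification asked only queries on which the two oracles agree, and the
    same coins make the uncut verification accept with [O]. *)
Lemma chk_le v Q K z (O O' : oracle) :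
  (forall l (x : l.-tuple bool), ~~ ((qry x \in Q) && (qry x \notin K)) -> O l x = O' l x) ->
  coin_pr R O' (chk v Q K z) id <= coin_pr R O (fin v z) id.
Proof.
move=> agree; rewrite /chk /fin; case: ifP => // _.
apply: le_trans (coin_pr_cap R O q L (ver S v.1 (outp v.1 z).1 (outp v.1 z).2) id).
have := @coin_pr_untilF R _ _ _ (verc v.1 (outp v.1 z).1 (outp v.1 z).2)
  (fun x => (x \in Q) && (x \notin K)) (fun o => if o is Some a then id a else false) agree.
rewrite !coin_prE cex_obind; apply: le_trans; apply: cex_le => p /=.
rewrite ler_nat -all_predC.
have -> : all (predC (fun x => (x \in Q) && (x \notin K))) p.2 = all (safe Q K) p.2.
  by apply: eq_all => x; rewrite /= negb_and negbK.
by case: p.1 => [[]|].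
Qed.

Variables (k T : nat).

Definition attack_forge v : ocomp (option (msg * bitseq)) :=
  forge0 L (den keysig).-1 keysig visible (search k) chk learn v T.

Definition attack : adversary n :=
  @Adversary n (Ret a0) (fun=> erefl)
    (fun vk _ s => obind (attack_forge (vk, s)) (fun z => Ret (outp vk z))).

Lemma nqueries_reps A O (c : ocomp A) t a :
  (nqueries O c <= a)%N -> (nqueries O (reps t c) <= t * a)%N.
Proof.
move=> hc; elim: t => [|t IH] //=.
rewrite mulSn; apply: (@leq_trans (nqueries O c + t * a)).
  by apply: nqueries_obind => // x; rewrite nqueries_obind_ret.
by rewrite leq_add2r.
Qed.

Lemma qlen_reps A (c : ocomp A) t : (qlen c <= L -> qlen (reps t c) <= L)%N.
Proof.
move=> hc; elim: t => [|t IH] //=.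
by apply: qlen_obind => // a; apply: qlen_obind.
Qed.

Lemma nqueries_search O k' b Q K : (nqueries O (search k' b Q K) <= k' * (q + nt * q))%N.
Proof.
elim: k' => [|k' IH] //; rewrite mulSn -[X in (_ <= X)%N]add0n.
apply: nqueries_obind; first by rewrite nqueries_unif.
move=> m; rewrite -addnA; apply: nqueries_obind; first exact: nqueries_cap.
move=> [s|]; last by apply: leq_trans IH _; rewrite leq_addl.
apply: nqueries_obind => [|p]; last by case: ifP.
by rewrite nqueries_trace; apply: nqueries_reps; apply: nqueries_cap.
Qed.

Lemma qlen_search k' b Q K : (qlen (search k' b Q K) <= L)%N.
Proof.
elim: k' => [|k' IH] //; apply: qlen_obind; first exact: qlen_unif.
move=> m; apply: qlen_obind; first exact: qlen_cap.
move=> [s|] //; apply: qlen_obind => [|p]; last by case: ifP.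
by apply: qlen_trace; apply: qlen_reps; apply: qlen_cap.
Qed.

Lemma nqueries_chk O v Q K z : (nqueries O (chk v Q K z) <= q)%N.
Proof.
rewrite /chk; case: ifP => // _; rewrite nqueries_obind_ret nqueries_trace.
exact: nqueries_cap.
Qed.

Lemma qlen_chk v Q K z : (qlen (chk v Q K z) <= L)%N.
Proof.
rewrite /chk; case: ifP => // _; apply: qlen_obind => //.
by apply: qlen_trace; apply: qlen_cap.
Qed.

Local Notation rnds := (rounds L (den keysig).-1 keysig visible (search k) chk).

Lemma nqueries_rounds O v K0 r kn :
  (nqueries O (rnds v K0 r kn) <= r.+1 * (k * (q + nt * q) + q))%N.
Proof.
elim: r kn => [|r IH] kn; rewrite mulSn -[X in (_ <= X)%N]add0n.
  apply: nqueries_obind; first by rewrite nqueries_unif.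
  move=> w; rewrite nqueries_obind_ret nqueries_patch mul0n addn0.
  by apply: leq_trans (nqueries_search _ _ _ _ _) _; rewrite leq_addr.
apply: nqueries_obind; first by rewrite nqueries_unif.
move=> w; apply: nqueries_obind => [|p]; last exact: IH.
rewrite nqueries_patch; apply: nqueries_obind; first exact: nqueries_search.
by move=> z; apply: nqueries_chk.
Qed.

Lemma qlen_rounds v K0 r kn : (qlen (rnds v K0 r kn) <= L)%N.
Proof.
elim: r kn => [|r IH] kn; apply: qlen_obind; try exact: qlen_unif.
  move=> w; apply: qlen_obind => //; apply: qlen_patch; exact: qlen_search.
move=> w; apply: qlen_obind => [|p]; last exact: IH.
apply: qlen_patch; apply: qlen_obind; first exact: qlen_search.
by move=> z; apply: qlen_chk.
Qed.

Lemma qlen_attack_forge v : (qlen (attack_forge v) <= L)%N.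
Proof.
apply: qlen_obind.
  by apply: qlen_patch; apply: qlen_reps; apply: qlen_cap.
by move=> p; apply: qlen_obind => [|r]; [exact: qlen_unif|exact: qlen_rounds].
Qed.

(** The bound on [f] is asked on the support because the drawn number of rounds is below [T] only
    there. *)
Lemma nqueries_obind_supp A B O (c : ocomp A) (f : A -> ocomp B) (a b : nat) :
  (nqueries O c <= a)%N -> (forall x, supp O c x -> nqueries O (f x) <= b)%N ->
  (nqueries O (obind c f) <= a + b)%N.
Proof.
elim: c a => [x|l x k' IH|m k' IH] a /= + hf.
- by move=> _; rewrite (leq_trans (hf _ _)) // leq_addl.
- by case: a => // a h; rewrite addSn ltnS IH.
- move=> /bigmax_leqP h; apply/bigmax_leqP => i _; apply: IH; first exact: h.
  by move=> x sx; apply: hf; exists i.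
Qed.

Lemma attack_queries (B : R) : (0 < T)%N ->
  (nt0 * q + T * (k * (q + nt * q) + q))%:R <= B -> adv_queries_le attack B.
Proof.
move=> T0 hB O vk m s; apply: le_trans hB; rewrite ler_nat /= nqueries_obind_ret.
apply: nqueries_obind.
  by rewrite nqueries_patch; apply: nqueries_reps; apply: nqueries_cap.
move=> p; rewrite -[X in (_ <= X)%N]add0n; apply: nqueries_obind_supp.
  by rewrite nqueries_unif.
move=> r /supp_unif; rewrite size_iota => /(_ T0); rewrite mem_iota add0n => /= rT.
by apply: leq_trans (nqueries_rounds _ _ _ _ _) _; rewrite leq_mul2r rT orbT.
Qed.

Lemma honest_runE : honest_run S a0 = obind keysig (fun b => ver S b.1.2 a0 b.2).
Proof.
rewrite /keysig obindA; congr obind; apply/funext => kk; rewrite obindA.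
by congr obind; apply/funext.
Qed.

Definition ideal_value O b Q K : R :=
  coin_pr R O (obind (search k b Q K) (chk (visible b) Q K)) id.

(** The experiment without fake worlds: [a0] and the candidates are signed with the genuine keys. *)
Definition ideal_pr O : R :=
  cex O (trace keysig) (fun p => cex O (trace (learn (visible p.1)))
    (fun p' => ideal_value O p.1 p.2 p'.2)).

Hypothesis hL : (qlen (honest_run S a0) <= L)%N.
Hypothesis hq : total_queries_le S q.

(** The forging part stays below [L] by its cuts, the final verification by the test in [outp], and
    the rest is shared with the honest run. *)
Lemma qlen_break : (qlen (break_game S attack) <= L)%N.
Proof.
move: hL; rewrite /honest_run /break_game; apply: qlen_obind_mono => kk /=.
apply: qlen_obind_mono => s _; rewrite obindA.
apply: qlen_obind; first exact: qlen_attack_forge.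
move=> z /=; case: ifP => // h; rewrite /outp in h *; case: z h => [ms|]; last by rewrite eqxx.
by case: ifP => //=; rewrite eqxx.
Qed.

Lemma attack_ge : (0 < T)%N ->
  (\sum_(f : foracle L) ideal_pr (extend f)) / #|{: foracle L}|%:R - q%:R / T%:R
  <= break_pr R S attack.
Proof.
move=> T0; rewrite /break_pr -(ro_pr_uptoE _ _ qlen_break) /ro_pr_upto.
(* With [M.+1 = den keysig] a uniform world is a uniform oracle together with exact coins of
   [keysig]. *)
pose M := (den keysig).-1.
have M1 : M.+1 = den keysig by rewrite prednK // den_gt0.
have dM : (den keysig %| M.+1)%N by rewrite M1.
have size_out (w : world L M) : (size (out keysig w).2 <= q)%N.
  apply: leq_trans (supp_size (run_supp _ _ _)) _.
  by apply: leq_trans (hq (ov w) a0); rewrite honest_runE nqueries_obind_le.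
have e1 : \sum_(f : foracle L) coin_pr R (extend f) (break_game S attack) id * M.+1%:R =
   \sum_(w : world L M) cex (ov w) (attack_forge (vs keysig visible w))
     (fun z => coin_pr R (ov w) (fin (vs keysig visible w) z) id).
  transitivity (\sum_(f : foracle L) \sum_(i < M.+1) cex (extend f)
    (attack_forge (visible (run (extend f) keysig i).1))
    (fun z => coin_pr R (extend f) (fin (visible (run (extend f) keysig i).1) z) id)); last first.
    exact: pair_bigA.
  apply: eq_bigr => f _.
  rewrite (sum_run (extend f) (fun p => cex (extend f) (attack_forge (visible p.1))
    (fun z => coin_pr R (extend f) (fin (visible p.1) z) id)) dM) mulrC; congr (_ * _).
  rewrite (cex_trace _ _ (fun b => cex (extend f) (attack_forge (visible b))
    (fun z => coin_pr R (extend f) (fin (visible b) z) id))).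
  rewrite coin_prE /break_game /keysig !cex_obind; apply: cex_eq => kk /=.
  rewrite !cex_obind; apply: cex_eq => s /=.
  rewrite -[obind (attack_forge _) _]/(obind (attack_forge (visible (kk, s))) (fun z => Ret (outp kk.2 z))).
  rewrite 2!cex_obind; apply: cex_eq => z.
  by rewrite coin_prE.
have e2 : \sum_(f : foracle L) ideal_pr (extend f) * M.+1%:R =
   \sum_(w : world L M) cex (ov w) (trace (learn (vs keysig visible w)))
     (fun p => ideal R keysig visible (search k) chk w p.2).
  transitivity (\sum_(f : foracle L) \sum_(i < M.+1) cex (extend f)
    (trace (learn (visible (run (extend f) keysig i).1)))
    (fun p => ideal_value (extend f) (run (extend f) keysig i).1 (run (extend f) keysig i).2 p.2)); last first.
    exact: pair_bigA.
  apply: eq_bigr => f _.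
  by rewrite (sum_run (extend f) (fun p => cex (extend f) (trace (learn (visible p.1)))
    (fun p' => ideal_value (extend f) p.1 p.2 p'.2)) dM) mulrC.
have := @forge_ge R L M _ _ _ _ keysig visible (search k) chk fin learn chk_le T q T0 size_out.
rewrite -e1 (eq_bigr (fun w => cex (ov w) (trace (learn (vs keysig visible w)))
  (fun p => ideal R keysig visible (search k) chk w p.2) - q%:R / T%:R)) // sumrB -e2 sumr_const.
rewrite -/M card_prod card_ord -[(q%:R / T%:R) *+ _]mulr_natr natrM -!mulr_suml mulrA -mulrBl ler_pM2r ?ltr0n //.
have N0 : 0 < #|{: foracle L}|%:R :> R.
  by rewrite ltr0n; apply/card_gt0P; exists [ffun l => [ffun x => x]].
move=> h; rewrite ler_pdivlMr // mulrBl divfK ?gt_eqF //.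
Qed.

End Attack.

(** * Success probability in an honest execution *)

Section QuerySets.
Variable L : nat.

Definition short_query : finType := {l : 'I_L & l.-tuple bool}.
Definition to_query (x : short_query) : query := qry (tagged x).

Lemma to_query_inj : injective to_query.
Proof.
move=> [l x] [l' x'] /eqP; rewrite /to_query /qry /=.
have [e|ne] := eqVneq l l'.
  by subst l'; rewrite eq_Tagged /= => /eqP ->.
by move=> /eqP /(congr1 tag) /= /val_inj e; rewrite e eqxx in ne.
Qed.

Definition qset (s : seq query) : {set short_query} := finset (fun x => to_query x \in s).

Lemma card_qset s : (#|qset s| <= size s)%N.
Proof.
rewrite cardE -(size_map to_query); apply: uniq_leq_size.
  by rewrite map_inj_uniq ?enum_uniq //; apply: to_query_inj.
by move=> y /mapP[x + ->]; rewrite mem_enum inE.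
Qed.

Lemma to_query_onto (x : query) : (tag x < L)%N -> exists y, to_query y = x.
Proof.
by case: x => l x /= lL; exists (existT _ (Ordinal lL) x).
Qed.

Lemma qset_safe (Q K V : seq query) : all (fun x : query => tag x < L)%N V ->
  [disjoint qset Q :\: qset K & qset V] -> all (safe Q K) V.
Proof.
move=> /allP hV; rewrite -finset.setI_eq0 => /eqP d; apply/allP => x xV.
have [y yx] := to_query_onto (hV _ xV).
apply/orP; have [xQ|] := boolP (x \in Q); last by left.
right; apply/negPn/negP => xK.
have : y \in (qset Q :\: qset K) :&: qset V by rewrite !inE yx xV xQ xK.
by rewrite d inE.
Qed.

End QuerySets.

(** * Two honest signatures under one key *)

Section Estimates.
Variables (R : realType) (n : nat) (S : sigScheme n) (q L : nat).
Local Notation msg := (n.-tuple bool).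
Hypothesis hL : forall m, (qlen (honest_run S m) <= L)%N.
Hypothesis hq : total_queries_le S q.
Hypothesis hc : complete_with S (9 / 10 : R).

Definition msg0 : msg := [tuple of nseq n false].

Definition cand (k : bitseq * bitseq) : ocomp (msg * bitseq * seq query) :=
  obind (unif msg0 (msgs n)) (fun m =>
  obind (trace (sign S k.1 m)) (fun p => Ret (m, p.1, p.2))).

Definition sample (k : bitseq * bitseq) (t : nat) :
    ocomp (msg * bitseq * seq query * (seq (option bool) * seq query)) :=
  obind (cand k) (fun c =>
  obind (trace (reps t (verc S q L k.2 c.1.1 c.1.2))) (fun p => Ret (c, p))).

Lemma size_msgs : size (msgs n) = (2 ^ n)%N.
Proof. by rewrite /msgs -cardE card_tuple card_bool. Qed.

Lemma cex_msgs O (a : msg) (F : msg -> R) :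
  cex O (unif a (msgs n)) F = (\sum_m F m) / (2 ^ n)%:R.
Proof.
by rewrite cex_unif size_msgs ?expn_gt0 // /msgs big_enum.
Qed.

(** For a uniform message [a0], its signing and the initial verifications together form one
    [sample]. *)
Lemma ideal_avg nt0 nt k O :
  \sum_a ideal_pr R S q L nt0 nt a k O / (2 ^ n)%:R =
  cex O (trace (gen S)) (fun p => cex O (sample p.1 nt0) (fun i =>
    ideal_value R S q L nt i.1.1.1 k O (p.1, i.1.1.2) (p.2 ++ i.1.2) i.2.2)).
Proof.
rewrite -mulr_suml.
transitivity ((\sum_a cex O (trace (gen S)) (fun p =>
  cex O (trace (sign S p.1.1 a)) (fun p1 =>
  cex O (trace (reps nt0 (verc S q L p.1.2 a p1.1))) (fun p2 =>
    ideal_value R S q L nt a k O (p.1, p1.1) (p.2 ++ p1.2) p2.2)))) / (2 ^ n)%:R).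
  congr (_ / _); apply: eq_bigr => a _.
  rewrite /ideal_pr /keysig cex_trace_obind; apply: cex_eq => p /=.
  rewrite cex_trace_obind; apply: cex_eq => p1 /=.
  by rewrite cats0.
rewrite -cex_sum mulrC -cexZ; apply: cex_eq => p.
rewrite /sample cex_obind /cand cex_obind cex_msgs mulrC; congr (_ / _).
apply: eq_bigr => a _; rewrite cex_obind; apply: cex_eq => p1 /=.
by rewrite cex_obind.
Qed.

Section FixedKey.
Variables (O : oracle) (k : bitseq * bitseq) (G : seq query).
Hypothesis hk : supp O (trace (gen S)) (k, G).

Lemma key_queries m :
  (size G + nqueries O (obind (sign S k.1 m) (fun s => ver S k.2 m s)) <= q)%N.
Proof.
apply: leq_trans (hq O m).
exact: (supp_nqueries (fun k => obind (sign S k.1 m) (fun s => ver S k.2 m s)) hk).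
Qed.

Lemma sign_nqueries m : (nqueries O (sign S k.1 m) <= q)%N.
Proof.
apply: leq_trans (key_queries m); apply: leq_trans (leq_addl _ _).
exact: nqueries_obind_le.
Qed.

Lemma key_qlen m : (qlen (obind (sign S k.1 m) (fun s => ver S k.2 m s)) <= L)%N.
Proof. exact: (supp_qlen (f := fun k => obind (sign S k.1 m) (fun s => ver S k.2 m s)) (trace_supp hk) (hL m)). Qed.

Lemma sign_qlen m : (qlen (sign S k.1 m) <= L)%N.
Proof. by apply: leq_trans (key_qlen m); apply: qlen_obind_le. Qed.

Lemma supp_cand c : supp O (cand k) c -> supp O (trace (sign S k.1 c.1.1)) (c.1.2, c.2).
Proof.
by move=> /supp_obind[m _ /supp_obind[p sp <-]] /=; case: p sp.
Qed.

Section Candidate.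
Variable c : msg * bitseq * seq query.
Hypothesis sc : supp O (cand k) c.
Local Notation m := c.1.1.
Local Notation s := c.1.2.

Lemma cand_queries : (size G + size c.2 + nqueries O (ver S k.2 m s) <= q)%N.
Proof.
apply: leq_trans (key_queries m); rewrite -addnA leq_add2l.
exact: (supp_nqueries (fun s => ver S k.2 m s) (supp_cand sc)).
Qed.

Lemma ver_nqueries : (nqueries O (ver S k.2 m s) <= q)%N.
Proof. by apply: leq_trans cand_queries; rewrite leq_addl. Qed.

Lemma ver_qlen : (qlen (ver S k.2 m s) <= L)%N.
Proof.
exact: (supp_qlen (f := fun s => ver S k.2 m s) (trace_supp (supp_cand sc)) (key_qlen m)).
Qed.

Lemma ver_accepts :
  9 / 10 <= cex O (trace (verc S q L k.2 m s)) (fun p => (p.1 == Some true)%:R) :> R.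
Proof.
rewrite cex_cap ?ver_nqueries ?ver_qlen //.
rewrite (cex_trace _ _ (fun b => (Some b == Some true)%:R)).
have p1 : 0 < coin_pr R O (gen S) (pred1 (k.1, k.2)).
  apply: (@supp_coin_pr R _ O _ k); first exact: trace_supp hk.
  by case: k => ? ? /=; rewrite eqxx.
have p2 : 0 < coin_pr R O (sign S k.1 m) (pred1 s).
  by apply: (@supp_coin_pr R _ O _ s); [exact: trace_supp (supp_cand sc)|rewrite /= eqxx].
have := hc p1 p2; rewrite coin_prE. move=> h; apply: (le_trans h); apply: cex_le => -[] //=.
Qed.

End Candidate.

Section Search.
Variables (nt : nat) (a0 : msg) (s0 : bitseq) (Q K : seq query).

Definition safe_pr (c : msg * bitseq * seq query) : R :=
  cex O (trace (verc S q L k.2 c.1.1 c.1.2)) (fun p => (all (safe Q K) p.2)%:R).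

Definition forge_pr (z : option (msg * bitseq)) : R :=
  coin_pr R O (chk S q L a0 (k.2, s0) Q K z) id.

Definition pass_pr (t : nat) (c : msg * bitseq * seq query) : R :=
  (c.1.1 != a0)%:R * safe_pr c ^+ t.

Lemma reps_all A (c : ocomp A) (P : pred query) t :
  cex O (trace (reps t c)) (fun p => (all P p.2)%:R) =
  cex O (trace c) (fun p => (all P p.2)%:R) ^+ t :> R.
Proof.
elim: t => [|t IH] //=; rewrite exprS -IH cex_trace_obind mulrC -cexZ.
apply: cex_eq => p; rewrite cex_trace_obind mulrC -cexZ; apply: cex_eq => p' /=.
by rewrite cats0 all_cat -natrM mulnb.
Qed.

Lemma safe_pr01 c : 0 <= safe_pr c <= 1.
Proof.
apply/andP; split; first exact: cex_ge0.
rewrite -[leRHS](cex_const O (trace (verc S q L k.2 c.1.1 c.1.2))).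
by apply: cex_le => p; rewrite lern1 leq_b1.
Qed.

Lemma pass_pr01 t c : 0 <= pass_pr t c <= 1.
Proof.
have /andP[h0 h1] := safe_pr01 c; rewrite /pass_pr.
by rewrite mulr_ge0 ?exprn_ge0 // mulr_ile1 ?exprn_ge0 ?exprn_ile1 // lern1 leq_b1.
Qed.

Definition avg_pass t : R := cex O (cand k) (pass_pr t).
Definition avg_forge t : R :=
  cex O (cand k) (fun c => pass_pr t c * forge_pr (Some (c.1.1, c.1.2))).

Definition search_value j : R :=
  cex O (search S q L nt a0 j (k, s0) Q K) forge_pr.

Lemma search_value0 : search_value 0 = 0.
Proof. by rewrite /search_value /= /forge_pr /chk /= eqxx. Qed.

(** One attempt either passes its tests and is used, or fails with probability [1 - avg_pass nt],
    and the search goes on. *)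
Lemma search_valueS j :
  search_value j.+1 = avg_forge nt + (1 - avg_pass nt) * search_value j.
Proof.
transitivity (cex O (cand k) (fun c =>
  pass_pr nt c * forge_pr (Some (c.1.1, c.1.2)) + search_value j -
  search_value j * pass_pr nt c)); last first.
  rewrite cexB cexD cexZ cex_const -/(avg_forge nt) -/(avg_pass nt); ring.
rewrite {1}/search_value /cand !cex_obind !cex_msgs; congr (_ / _).
apply: eq_bigr => m _; rewrite !cex_obind /=.
rewrite -(cex_trace _ (cap q L (sign S k.1 m))) cex_cap ?sign_nqueries ?sign_qlen //.
apply: cex_eq => p /=; rewrite cex_obind.
rewrite (cex_eq _ _ (G := fun p' => (m != a0)%:R *
   (forge_pr (Some (m, p.1)) - search_value j) * (all (safe Q K) p'.2)%:R + search_value j)); last first.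
  move=> p'; case: (m != a0); case: (all _ _) => /=; rewrite -/(search_value j); ring.
rewrite cexD cexZ cex_const reps_all /pass_pr /safe_pr /=; ring.
Qed.

Lemma forge_pr_ge0 z : 0 <= forge_pr z.
Proof. by rewrite /forge_pr coin_prE; apply: cex_ge0. Qed.

Lemma forge_pr_cand c : supp O (cand k) c -> c.1.1 != a0 ->
  forge_pr (Some (c.1.1, c.1.2)) =
  cex O (trace (verc S q L k.2 c.1.1 c.1.2))
    (fun p => ((p.1 == Some true) && all (safe Q K) p.2)%:R).
Proof.
move=> sc ne; rewrite /forge_pr /chk /outp /= ver_qlen //= (negbTE ne).
by rewrite coin_prE cex_obind.
Qed.

(** Union bound: an honest signature is rejected with probability at most 1/10. *)
Lemma forge_pr_ge c : supp O (cand k) c -> c.1.1 != a0 ->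
  safe_pr c - 1 / 10 <= forge_pr (Some (c.1.1, c.1.2)).
Proof.
move=> sc ne; rewrite forge_pr_cand //.
have acc := ver_accepts sc.
have : cex O (trace (verc S q L k.2 c.1.1 c.1.2)) (fun p => (p.1 == Some true)%:R)
   + safe_pr c - 1 <= cex O (trace (verc S q L k.2 c.1.1 c.1.2))
    (fun p => ((p.1 == Some true) && all (safe Q K) p.2)%:R) :> R.
  rewrite -[X in _ - X](cex_const O (trace (verc S q L k.2 c.1.1 c.1.2))) -cexD -cexB.
  by apply: cex_le => p; case: (_ == _); case: all => /=; lra.
lra.
Qed.

(** A candidate with [safe_pr] at least 9/10 forges with probability at least 8/10. The others pass
    [t] tests with probability at most [(9 / 10) ^+ t], which is at most a tenth of [avg_pass t]. *)
Lemma avg_forge_ge (delta : R) t : (9 / 10) ^+ t <= delta / 10 -> delta <= avg_pass t ->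
  7 / 10 * avg_pass t <= avg_forge t.
Proof.
move=> hd ha; suff : 8 / 10 * avg_pass t - (9 / 10) ^+ t <= avg_forge t by lra.
rewrite -cexZ -(cex_const O (cand k) ((9 / 10) ^+ t)) -cexB; apply: cex_le_supp => c sc.
have h9 : 0 <= (9 / 10 : R) ^+ t by rewrite exprn_ge0.
rewrite /pass_pr; case: (boolP (c.1.1 == a0)) => ne; first by rewrite !mul0r; lra.
rewrite !mul1r; have /andP[h0 h1] := safe_pr01 c.
have p0 : 0 <= safe_pr c ^+ t by rewrite exprn_ge0.
have [hs|hs] := lerP (9 / 10) (safe_pr c).
  have := forge_pr_ge sc ne => hf.
  have : safe_pr c ^+ t * (8 / 10) <= safe_pr c ^+ t * forge_pr (Some (c.1.1, c.1.2)).
    by apply: ler_wpM2l => //; lra.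
  lra.
have : safe_pr c ^+ t <= (9 / 10) ^+ t by apply: lerXn2r; rewrite ?nnegrE //; lra.
have : 0 <= safe_pr c ^+ t * forge_pr (Some (c.1.1, c.1.2)) by rewrite mulr_ge0 ?forge_pr_ge0.
lra.
Qed.

Lemma avg_pass01 t : 0 <= avg_pass t <= 1.
Proof.
apply/andP; split; first by apply: cex_ge0 => c _; have /andP[] := pass_pr01 t c.
by rewrite -[leRHS](cex_const O (cand k)); apply: cex_le => c; have /andP[] := pass_pr01 t c.
Qed.

Lemma search_value_ge (delta : R) j :
  0 < delta <= 1 -> (9 / 10) ^+ nt <= delta / 10 -> delta <= avg_pass nt ->
  7 / 10 * (1 - (1 - delta) ^+ j) <= search_value j.
Proof.
move=> /andP[d0 d1] hd ha; elim: j => [|j IH].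
  by rewrite search_value0 expr0 subrr mulr0.
rewrite search_valueS; have := avg_forge_ge hd ha; have /andP[a0' a1] := avg_pass01 nt.
set a := avg_pass nt in ha a0' a1 *; set x := (1 - delta) ^+ j in IH *.
have x0 : 0 <= x by rewrite exprn_ge0 // subr_ge0.
rewrite exprS -/x => hm.
have : (1 - a) * (7 / 10 * (1 - x)) <= (1 - a) * search_value j by apply: ler_wpM2l => //; lra.
have : (1 - a) * x <= (1 - delta) * x by apply: ler_wpM2r => //; lra.
lra.
Qed.

Lemma search_value_ge0 j : 0 <= search_value j.
Proof. by apply: cex_ge0 => z _; apply: forge_pr_ge0. Qed.

Lemma cand_msg_eq : cex O (cand k) (fun c => (c.1.1 == a0)%:R) = (2 ^ n)%:R^-1 :> R.
Proof.
rewrite /cand cex_obind cex_msgs (bigD1 a0) //= big1; last first.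
  move=> m ne; rewrite cex_obind -[RHS](cex_const O (trace (sign S k.1 m))).
  by apply: cex_eq => p /=; rewrite (negbTE ne).
rewrite cex_obind -[RHS]mul1r addr0; congr (_ / _).
by rewrite -[RHS](cex_const O (trace (sign S k.1 a0))); apply: cex_eq => p /=; rewrite eqxx.
Qed.

Lemma safe_le_pass t :
  cex O (cand k) (fun c => safe_pr c ^+ t) <= avg_pass t + (2 ^ n)%:R^-1.
Proof.
rewrite -cand_msg_eq -cexD; apply: cex_le => c; rewrite /pass_pr.
have /andP[h0 h1] := safe_pr01 c.
by case: eqP => _ /=; rewrite ?mul0r ?add0r ?mul1r ?addr0 // exprn_ile1.
Qed.

Lemma sample_safe t :
  cex O (sample k t) (fun i => (all (safe Q K) i.2.2)%:R) =
  cex O (cand k) (fun c => safe_pr c ^+ t).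
Proof.
rewrite /sample cex_obind; apply: cex_eq => c; rewrite cex_obind /=.
by rewrite -reps_all.
Qed.

Lemma ideal_valueE j :
  ideal_value R S q L nt a0 j O (k, s0) Q K = search_value j.
Proof.
rewrite /ideal_value coin_prE cex_obind; apply: cex_eq => z.
by rewrite /forge_pr coin_prE.
Qed.

End Search.

Local Notation idx := (msg * bitseq * seq query * (seq (option bool) * seq query))%type.
Implicit Types i : idx.

Definition secret_set i : {set short_query L} :=
  qset L (G ++ i.1.2) :\: qset L i.2.2.
Definition ver_set i : {set short_query L} := qset L i.2.2.

Lemma supp_sample t i : supp O (sample k t) i ->
  supp O (cand k) i.1 /\ supp O (trace (reps t (verc S q L k.2 i.1.1.1 i.1.1.2))) i.2.
Proof. by move=> /supp_obind[c sc /supp_obind[p sp <-]]. Qed.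

Lemma card_secret_set i : (#|secret_set i| <= size G + size i.1.2)%N.
Proof.
rewrite -size_cat; apply: leq_trans (card_qset L _); apply: subset_leq_card.
exact: finset.subsetDl.
Qed.

Lemma card_ver_set t i : supp O (sample k t) i ->
  (#|ver_set i| <= t * nqueries O (ver S k.2 i.1.1.1 i.1.1.2))%N.
Proof.
move=> /supp_sample[_ si]; apply: leq_trans (card_qset L _) _.
apply: leq_trans (supp_size si) _; apply: nqueries_reps.
exact: nqueries_cap_le.
Qed.

(** [secret_set i] and [ver_set i] are disjoint by construction, so the set-pair inequality applies;
    disjointness of [secret_set i] from [ver_set j] makes the verifications of [j] safe for [i]. *)
Lemma sample_cross t (Y : pred idx) (W : R) : 0 <= W ->
  (forall i, supp O (sample k t) i -> Y i ->
    'C(#|secret_set i| + #|ver_set i|, #|secret_set i|)%:R <= W) ->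
  cex O (sample k t) (fun i => (Y i)%:R) ^+ 2 <= 2 * W *
  cex O (sample k t) (fun i => (Y i)%:R * cex O (sample k t) (fun j =>
    (Y j && all (safe (G ++ i.1.2) i.2.2) j.2.2)%:R)).
Proof.
move=> W0 hW.
apply: le_trans (cross_disjoint_pr (A := secret_set) (B := ver_set) (W := W) _) _.
  move=> i si Yi; split; last exact: hW.
  by rewrite -finset.setI_eq0 /secret_set /ver_set finset.setIDAC finset.setDIl finset.setDv finset.setI0.
apply: ler_wpM2l; first by rewrite mulr_ge0.
apply: cex_le => i; rewrite -cexZ; apply: cex_le_supp => j sj.
rewrite -natrM mulnb -andbA ler_nat.
case: (Y i) => //; case: (Y j) => //=; case: (boolP [disjoint _ & _]) => // d.
rewrite (@qset_safe L) //.
have [_ sj2] := supp_sample sj; apply: supp_tag sj2.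
exact/qlen_reps/qlen_cap.
Qed.

(** Samples with pass probability below [delta] are given up, which costs at most a fraction
    1/25. *)
Lemma search_sample_ge t j (delta : R) : 0 < delta <= 1 ->
  (9 / 10) ^+ t <= delta / 10 ->
  cex O (sample k t) (fun i =>
    (avg_pass i.1.1.1 (G ++ i.1.2) i.2.2 t < delta)%R%:R) <= 1 / 25 :> R ->
  24 / 25 * (7 / 10 * (1 - (1 - delta) ^+ j)) <=
  cex O (sample k t) (fun i => ideal_value R S q L t i.1.1.1 j O
     (k, i.1.1.2) (G ++ i.1.2) i.2.2).
Proof.
move=> d01 hd; set c0 := 7 / 10 * _; set y := cex _ _ _ => hy.
have /andP[d0 d1] := d01.
have c00 : 0 <= c0.
  by rewrite mulr_ge0 // subr_ge0 exprn_ile1 ?subr_ge0 // lerBlDr lerDl ltW.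
apply: (@le_trans _ _ (c0 - c0 * y)); first by have := ler_wpM2l c00 hy; lra.
rewrite -{1}(cex_const O (sample k t) c0) -cexZ -cexB; apply: cex_le => i.
rewrite ideal_valueE; case: ltP => h.
  by rewrite mulr1 subrr search_value_ge0.
by rewrite mulr0 subr0; apply: search_value_ge.
Qed.

(** Let [y] be the probability of a sample with low pass probability. Given such a sample, a second
    one is safe with probability at most [2 * delta], so the set-pair inequality gives y^2 <= 4 W
    delta y. *)
Lemma low_pass_pr t (delta W : R) : 0 <= delta -> 0 <= W ->
  (forall i, supp O (sample k t) i ->
    'C(#|secret_set i| + #|ver_set i|, #|secret_set i|)%:R <= W) ->
  (2 ^ n)%:R^-1 <= delta ->
  cex O (sample k t) (fun i =>
    (avg_pass i.1.1.1 (G ++ i.1.2) i.2.2 t < delta)%R%:R) <= 4 * W * delta :> R.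
Proof.
move=> d0 W0 hW hn; pose Y i := avg_pass i.1.1.1 (G ++ i.1.2) i.2.2 t < delta.
set y := cex _ _ _.
have y0 : 0 <= y by apply: cex_ge0.
have : y ^+ 2 <= 2 * W * (2 * delta * y).
  apply: le_trans (sample_cross (Y := Y) W0 _) _; first by move=> i si _; apply: hW.
  apply: ler_wpM2l; first by rewrite mulr_ge0.
  rewrite -cexZ; apply: cex_le => i; rewrite mulrC -/(Y i).
  case: (boolP (Y i)) => Yi; rewrite ?mulr0 // !mulr1.
  apply: (@le_trans _ _ (cex O (sample k t) (fun j => (all (safe (G ++ i.1.2) i.2.2) j.2.2)%:R))).
    by apply: cex_le => j; case: (Y j).
  rewrite sample_safe; apply: le_trans (safe_le_pass i.1.1.1 _ _ _) _.
  by move: Yi; rewrite /Y; lra.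
have [->|yn] := eqVneq y 0; first by rewrite !mulr_ge0.
have yp : 0 < y by rewrite lt_neqAle eq_sym yn.
rewrite expr2 mulrA ler_pM2r // => h; apply: le_trans h _; lra.
Qed.

(** Nothing is secret when [q = 0], so every message other than the signed one passes, and these are
    at least half of all messages. *)
Lemma low_pass_noqueries t (delta : R) : q = 0%N -> (0 < n)%N -> delta <= 1 / 2 ->
  cex O (sample k t) (fun i =>
    (avg_pass i.1.1.1 (G ++ i.1.2) i.2.2 t < delta)%R%:R) <= 0 :> R.
Proof.
move=> q0 n0 d2; rewrite -[leRHS](cex_const O (sample k t)); apply: cex_le_supp => i si.
have [sc _] := supp_sample si.
have : (size G + size i.1.2 <= 0)%N.
  by rewrite -q0; apply: leq_trans (cand_queries sc); rewrite leq_addr.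
rewrite leqn0 -size_cat => /nilP eQ; rewrite eQ ltNge.
have -> // : delta <= avg_pass i.1.1.1 [::] i.2.2 t.
have -> : avg_pass i.1.1.1 [::] i.2.2 t = 1 - (2 ^ n)%:R^-1.
  rewrite -(cand_msg_eq i.1.1.1) -[X in X - _](cex_const O (cand k)) -cexB; apply: cex_eq => c.
  have -> : pass_pr i.1.1.1 [::] i.2.2 t c = (c.1.1 != i.1.1.1)%:R.
    rewrite /pass_pr; have -> : safe_pr [::] i.2.2 c = 1; last by rewrite expr1n mulr1.
    rewrite -[RHS](cex_const O (trace (verc S q L k.2 c.1.1 c.1.2))).
    apply: cex_eq => p; suff -> : all (safe [::] i.2.2) p.2 by [].
    by apply/allP.
  by case: eqP => _; rewrite /= ?mulr1n ?mulr0n ?subrr ?subr0.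
have : (2 ^ n)%:R^-1 <= (2 : R)^-1.
  rewrite lef_pV2 ?posrE ?ltr0n ?expn_gt0 // ler_nat -[X in (X <= _)%N]expn1.
  by rewrite leq_exp2l.
lra.
Qed.

(** [Y] has probability at least 9/10 by completeness, so the set-pair inequality gives 81/100 <= 2
    W (v + 2^-n); the term 2^-n accounts for a second message equal to the first. *)
Lemma single_sample_ge (W : R) : 0 < W ->
  (forall i, supp O (sample k 1) i ->
    'C(#|secret_set i| + #|ver_set i|, #|secret_set i|)%:R <= W) ->
  81 / 200 / W - (2 ^ n)%:R^-1 <=
  cex O (sample k 1) (fun i => ideal_value R S q L 0 i.1.1.1 1 O
     (k, i.1.1.2) (G ++ i.1.2) i.2.2).
Proof.
move=> W0 hW; pose Y i := i.2.1 == [:: Some true].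
set v := cex _ _ _.
have one (c : msg * bitseq * seq query) (F : bool -> seq query -> R) :
    cex O (trace (reps 1 (verc S q L k.2 c.1.1 c.1.2))) (fun p => F (p.1 == [:: Some true]) p.2) =
    cex O (trace (verc S q L k.2 c.1.1 c.1.2)) (fun p => F (p.1 == Some true) p.2) :> R.
  move: c => [[m s] Ss] /=; rewrite cex_trace_obind; apply: cex_eq => p /=.
  by rewrite cats0 eqseq_cons eqxx andbT.
have y9 : 9 / 10 <= cex O (sample k 1) (fun i => (Y i)%:R) :> R.
  rewrite /sample cex_obind -[leLHS](cex_const O (cand k)); apply: cex_le_supp => c sc.
  rewrite cex_obind /Y (one c (fun b _ => b%:R)); exact: ver_accepts.
have := sample_cross (Y := Y) (ltW W0) (fun i si _ => hW i si).
have hv : cex O (sample k 1) (fun i => (Y i)%:R * cex O (sample k 1) (fun j =>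
    (Y j && all (safe (G ++ i.1.2) i.2.2) j.2.2)%:R)) <= v + (2 ^ n)%:R^-1.
  rewrite -(cex_const O (sample k 1) (2 ^ n)%:R^-1) -cexD; apply: cex_le => i.
  set e := cex _ _ _.
  have e0 : 0 <= e by apply: cex_ge0.
  apply: (@le_trans _ _ e); first by case: (Y i); rewrite ?mul1r ?mul0r.
  rewrite ideal_valueE search_valueS search_value0 mulr0 addr0 -(cand_msg_eq i.1.1.1) -cexD.
  rewrite /e {1}/sample cex_obind; apply: cex_le_supp => c sc.
  rewrite cex_obind /Y (one c (fun b V => (b && all (safe (G ++ i.1.2) i.2.2) V)%:R)).
  rewrite /pass_pr expr0 mulr1; have [->|ne] := eqVneq c.1.1 i.1.1.1.
    rewrite mul0r add0r -[leRHS](cex_const O (trace (verc S q L k.2 i.1.1.1 c.1.2))).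
    by apply: cex_le => p; rewrite lern1 leq_b1.
  by rewrite addr0 mul1r forge_pr_cand.
move=> h; have h2 := le_trans h (ler_wpM2l (mulr_ge0 (ler0n R 2) (ltW W0)) hv).
rewrite lerBlDr ler_pdivrMr //.
have : (9 / 10) ^+ 2 <= cex O (sample k 1) (fun i => (Y i)%:R) ^+ 2 :> R.
  by apply: lerXn2r; rewrite ?nnegrE //; lra.
lra.
Qed.

End FixedKey.
End Estimates.

(** * Choice of parameters *)

Section Numerics.

(** Pascal's rule doubles the bound at each step, starting from ['C(8, 4) = 70]. The gain of 70/256
    over the trivial [2 ^ (8 + j)] pays for the losses of the cheap attack. *)
Lemma bin_le_half j a : ('C(8 + j, a) <= 70 * 2 ^ j)%N.
Proof.
elim: j a => [|j IH] a.
  by rewrite addn0 muln1; do 9 (case: a => [//|a]); rewrite bin_small.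
rewrite addnS expnS mulnCA mul2n -addnn; case: a => [|a].
  by rewrite bin0; apply: leq_trans (leq_addr _ _); rewrite (leq_trans _ (IH 0%N)) ?bin0.
by rewrite binS leq_add.
Qed.

Lemma leq_exp_base m m' a : (m <= m')%N -> (m ^ a <= m' ^ a)%N.
Proof. by case: a => // a h; rewrite leq_exp2r. Qed.

Lemma bin_le_exp m a : ('C(m, a) <= m ^ a)%N.
Proof.
elim: m a => [|m IH] [|a]; rewrite ?bin0 ?expn0 //.
rewrite binS expnS mulSn addnC; apply: leq_add.
  by apply: leq_trans (IH _) _; rewrite leq_exp_base ?leqnSn.
by apply: leq_trans (IH _) _; rewrite expnS leq_mul2l leq_exp_base ?leqnSn ?orbT.
Qed.


(** Bounds [(1 - d) ^+ j] by 1 / (1 + j d), which shows that a long search rarely fails. *)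
Lemma sub_exp_le (R : realType) (d : R) j :
  0 <= d <= 1 -> (1 - d) ^+ j * (1 + j%:R * d) <= 1.
Proof.
move=> /andP[d0 d1]; elim: j => [|j IH]; first by rewrite expr0 mul0r addr0 mulr1.
apply: le_trans IH; rewrite exprSr -mulrA; apply: ler_wpM2l.
  by rewrite exprn_ge0 // subr_ge0.
have j0 : 0 <= j%:R * (d * d) by rewrite !mulr_ge0.
have dd : 0 <= d * d by rewrite mulr_ge0.
by rewrite -natr1; lra.
Qed.

(** Fourth power of 4s <= 2^(8s), which follows from 1 + x <= exp x and ln 2 >= 1/2. With [s] the
    square root of [q] it absorbs the factor 21 q^2 of the cheap attack into the exponent. *)
Lemma powR2_ge (R : realType) (s : R) : 0 <= s -> 256 * s ^+ 4 <= 2 `^ (32 * s).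
Proof.
move=> s0.
have l2 : 2^-1 <= ln 2 :> R.
  rewrite -ler_expR lnK ?posrE //.
  have := expR_ge1Dx (- (2^-1) : R); rewrite expRN => h.
  rewrite -[leRHS]invrK -[leLHS]invrK lef_pV2 ?posrE ?invr_gt0 ?expR_gt0 //; lra.
have h : 4 * s <= 2 `^ (8 * s).
  rewrite /powR pnatr_eq0 /=; apply: le_trans (expR_ge1Dx _).
  have : 8 * s * 2^-1 <= 8 * s * ln 2 by apply: ler_wpM2l => //; rewrite mulr_ge0.
  lra.
have -> : 2 `^ (32 * s) = (2 `^ (8 * s)) ^+ 4 :> R.
  by rewrite -powR_mulrn ?powR_ge0 // -powRrM; congr (_ `^ _); ring.
have -> : 256 * s ^+ 4 = (4 * s) ^+ 4 by ring.
by apply: lerXn2r; rewrite ?nnegrE ?powR_ge0 ?mulr_ge0.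
Qed.

(** The number of verifications is 77 q^2 + 70. The binomial coefficient is at most (a + b)^a, and a
    + b is at most 2^(11q). *)
Lemma test_bound (q a b : nat) : (a <= q)%N -> (b <= (77 * q ^ 2 + 70) * q)%N ->
  ('C(a + b, a) <= 2 ^ (11 * q ^ 2))%N.
Proof.
move=> aq bq; apply: leq_trans (bin_le_exp _ _) _.
have hX : (a + b <= 2 ^ (11 * q))%N.
  apply: (@leq_trans (q + (77 * q ^ 2 + 70) * q)); first exact: leq_add.
  case: q {aq bq} => // q.
  have h := ltn_expl q.+1 (ltnSn 1).
  apply: (@leq_trans (2 ^ 8 * (2 ^ q.+1) ^ 3)); last first.
    by rewrite -expnM -expnD leq_exp2l //; lia.
  apply: (@leq_trans (2 ^ 8 * q.+1 ^ 3)); first by rewrite !expnS expn0; nia.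
  by rewrite leq_mul2l leq_exp_base ?orbT // ltnW.
apply: leq_trans (leq_exp_base _ hX) _.
rewrite -expnM leq_exp2l //; nia.
Qed.

(** The left side is the query count of the attack with [t] initial and [t] test verifications, 1900
    * 2^(11 q^2) candidates per round and at most 10 (q + 1) rounds. *)
Lemma queries_bound (q t : nat) : t = (77 * q ^ 2 + 70)%N ->
  (t * q + (10 * q.+1) * (1900 * 2 ^ (11 * q ^ 2) * (q + t * q) + q) <= 2 ^ (50 * q ^ 2))%N.
Proof.
case: q => [|q]; first by move=> _; rewrite !(muln0, addn0).
set p := q.+1 => et; set X := (2 ^ (11 * p ^ 2))%N.
have X0 : (0 < X)%N by rewrite expn_gt0.
have p0 : (0 < p)%N by [].
have h1 : (p + t * p <= 2 ^ 8 * p ^ 3)%N.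
  by rewrite et !expnS !expn0; nia.
have h2 : (1900 * X * (p + t * p) + p <= 2 ^ 20 * (X * p ^ 3))%N.
  apply: (@leq_trans (2 ^ 19 * (X * p ^ 3) + 2 ^ 19 * (X * p ^ 3))); last first.
    by rewrite addnn -mul2n mulnA -expnS.
  apply: leq_add.
    apply: (@leq_trans (2 ^ 11 * X * (2 ^ 8 * p ^ 3))); first by rewrite leq_mul // leq_mul2r orbT.
    by rewrite mulnACA -(expnD 2 11 8) leqnn.
  apply: (@leq_trans (X * p ^ 3)); last by rewrite leq_pmull ?expn_gt0.
  by rewrite expnS mulnCA leq_pmulr // muln_gt0 X0 expn_gt0.
have h3 : (10 * p.+1 <= 2 ^ 5 * p)%N by rewrite /=; lia.
have hp : (p ^ 4 <= 2 ^ (4 * p ^ 2))%N.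
  rewrite (mulnC 4) expnM; apply: leq_exp_base; apply: (@leq_trans (p ^ 2)%N).
    by rewrite leq_pmulr.
  exact/ltnW/ltn_expl.
apply: (@leq_trans (2 ^ 25 * (X * p ^ 4) + 2 ^ 25 * (X * p ^ 4))).
  apply: leq_add; last first.
    apply: leq_trans (leq_mul h3 h2) _.
    by rewrite mulnACA -(expnD 2 5 20) [(p * (X * _))%N]mulnCA -expnS leqnn.
  apply: leq_trans (leq_addl p _) _; apply: leq_trans h1 _.
  apply: leq_mul; first by rewrite leq_exp2l.
  by rewrite [(p ^ 4)%N]expnS mulnA leq_pmull // muln_gt0 X0.
rewrite addnn -mul2n mulnA -expnS.
apply: (@leq_trans (2 ^ 26 * (X * 2 ^ (4 * p ^ 2)))).
  by rewrite !leq_mul2l hp !orbT.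
rewrite -!expnD leq_exp2l //.
have : (1 <= p ^ 2)%N by rewrite expn_gt0.
lia.
Qed.

End Numerics.

(** * The two adversaries *)

Section Attacks.
Variable R : realType.

Lemma pred_avg (T : finType) (F : T -> R) (p : R) (N : nat) : #|T| = N -> (0 < N)%N ->
  p <= \sum_a F a / N%:R -> exists a, p <= F a.
Proof.
move=> cT N0 h; apply: contrapT => /forallNP no.
have [a0 _] : exists a0 : T, true by have /card_gt0P[a0 _] : (0 < #|T|)%N; [rewrite cT|exists a0].
have : \sum_a F a / N%:R < p.
  rewrite -mulr_suml ltr_pdivrMr ?ltr0n //.
  have -> : p * N%:R = \sum_(a : T) p by rewrite sumr_const -[p *+ _]mulr_natr cT.
  apply: ltr_sum; first by apply/hasP; exists a0 => //; rewrite mem_index_enum.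
  by move=> a _; rewrite ltNge; apply/negP/no.
by rewrite ltNge h.
Qed.

Lemma attack_exists n (S : sigScheme n) (q nt0 nt k T : nat) (p B : R) :
  (0 < T)%N -> total_queries_le S q ->
  (forall L, (forall m, (qlen (honest_run S m) <= L)%N) ->
   forall O (kG : bitseq * bitseq * seq query), supp O (trace (gen S)) kG ->
     p <= cex O (sample S q L kG.1 nt0) (fun i => ideal_value R S q L nt i.1.1.1 k O
       (kG.1, i.1.1.2) (kG.2 ++ i.1.2) i.2.2)) ->
  (nt0 * q + T * (k * (q + nt * q) + q))%:R <= B ->
  exists A : adversary n, adv_queries_le A B /\ p - q%:R / T%:R <= break_pr R S A.
Proof.
move=> T0 hq hp hB.
pose L := (\max_m qlen (honest_run S m))%N.
have hL m : (qlen (honest_run S m) <= L)%N by exact: (leq_bigmax (F := fun m => qlen (honest_run S m))).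
have N0 : 0 < #|{: foracle L}|%:R :> R.
  by rewrite ltr0n; apply/card_gt0P; exists [ffun l => [ffun x => x]].
(* The message to be signed is fixed as one that does at least as well as the average over all
   messages, hence independently of the key. *)
have [a ha] : exists a, p <= (\sum_(f : foracle L) ideal_pr R S q L nt0 nt a k (extend f)) / #|{: foracle L}|%:R.
  apply: (@pred_avg _ _ _ (2 ^ n)%N); rewrite ?expn_gt0 ?card_tuple ?card_bool //.
  rewrite -mulr_suml -mulr_suml exchange_big /= mulrAC ler_pdivlMr //.
  rewrite mulr_suml.
  have -> : p * #|{: foracle L}|%:R = \sum_(f : foracle L) p by rewrite sumr_const -[p *+ _]mulr_natr.
  apply: ler_sum => f _; rewrite mulr_suml ideal_avg.
  rewrite -[leLHS](cex_const (extend f) (trace (gen S))); apply: cex_le_supp => kG sk.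
  exact: hp.
exists (attack S q L nt0 nt a k T); split; first exact: attack_queries.
by have := attack_ge R nt0 nt k (hL a) hq T0; apply: le_trans; rewrite lerD2r.
Qed.

Lemma attack_const n (S : sigScheme n) (q : nat) :
  (0 < n)%N -> (400 * q ^ 2 <= n)%N -> complete_with S (9 / 10 : R) -> total_queries_le S q ->
  exists A : adversary n,
    adv_queries_le A (2 ^+ (50 * q ^ 2) : R) /\ 1 / 2 <= break_pr R S A.
Proof.
move=> n0 hn hc hq.
(* [U] bounds the binomial coefficient, [d] is chosen so that 4 U d = 1/25, and t = 7 (11 q^2 + 10)
   because (9/10)^7 <= 1/2. *)
pose U := (2 ^ (11 * q ^ 2))%N; pose t := (77 * q ^ 2 + 70)%N.
have U0 : 1 <= U%:R :> R by rewrite ler1n expn_gt0.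
pose d : R := (100 * U%:R)^-1.
have d01 : 0 < d <= 1 / 100.
  rewrite invr_gt0 mulr_gt0 ?ltr0n ?expn_gt0 //= div1r lef_pV2 ?posrE ?mulr_gt0 ?ltr0n ?expn_gt0 //.
  by lra.
have /andP[d0 d1] := d01.
have Ud : U%:R * d = 1 / 100 by rewrite /d; field; lra.
have dt : (9 / 10) ^+ t <= d / 10.
  have -> : t = (7 * (11 * q ^ 2 + 10))%N by rewrite /t; lia.
  rewrite exprM; apply: (@le_trans _ _ (2^-1 ^+ (11 * q ^ 2 + 10))).
    by apply: lerXn2r; rewrite ?nnegrE ?exprn_ge0 ?invr_ge0 //; lra.
  rewrite exprD exprVn -natrX -/U /d.
  have -> : (2^-1 : R) ^+ 10 = 1 / 1024 by rewrite exprVn -natrX; field.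
  rewrite invfM; have : 0 <= (U%:R : R)^-1 by rewrite invr_ge0; lra.
  by lra.
have hd : (0 < d <= 1)%R by apply/andP; split => //; lra.
(* Since k d = 19, the factor [(1 - d) ^+ k] is at most 1/20. *)
pose k := (1900 * U)%N.
have hk : (1 - d) ^+ k <= 1 / 20.
  have := @sub_exp_le R d k; have -> : 0 <= d <= 1 by apply/andP; split; lra.
  move=> /(_ isT).
  have -> : k%:R * d = 19 :> R by rewrite /k natrM -mulrA Ud; lra.
  by lra.
(* With T = 10 (q + 1) the loss q / T is below 1/10, and 24/25 * 7/10 * 19/20 - 1/10 exceeds 1/2. *)
have [||A [hA1 hA2]] := @attack_exists n S q t t k (10 * q.+1) (24 / 25 * (7 / 10 * (1 - 1 / 20)))
  (2 ^+ (50 * q ^ 2)) isT hq; last first.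
- exists A; split => //; apply: le_trans hA2.
  have : q%:R / (10 * q.+1)%:R <= 1 / 10 :> R.
    by rewrite ler_pdivrMr ?ltr0n // natrM -[q.+1%:R]natr1; lra.
  by move: (_ / _) => x; lra.
- by rewrite -natrX ler_nat; exact: queries_bound.
move=> L hL O [kk G] sk /=.
apply: le_trans (search_sample_ge hL hq hc sk k hd dt _).
  by have := hk; lra.
(* For [q = 0] the bound on [n] does not yield 2^-n <= d. *)
have [q0|q0] := posnP q.
  by apply: le_trans (low_pass_noqueries L hq sk t q0 n0 _) _; lra.
apply: (@le_trans _ _ (4 * U%:R * d)); last by rewrite -mulrA Ud; lra.
apply: low_pass_pr => //.
- exact: ltW.
- move=> i si; rewrite ler_nat; apply: test_bound.
    apply: leq_trans (card_secret_set _ _ _) _; have [sc _] := supp_sample si.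
    by apply: leq_trans (cand_queries hq sk sc); rewrite leq_addr.
  apply: leq_trans (card_ver_set si) _; have [sc _] := supp_sample si.
  by rewrite leq_mul2l (ver_nqueries hq sk sc) orbT.
- rewrite /d lef_pV2 ?posrE ?mulr_gt0 ?ltr0n ?expn_gt0 //.
  rewrite -natrM ler_nat; apply: (@leq_trans (2 ^ 7 * U)); first by rewrite leq_mul2r orbT.
  rewrite -expnD leq_exp2l //; apply: leq_trans hn.
  have : (1 <= q ^ 2)%N by rewrite expn_gt0 q0.
  lia.
Qed.

Lemma attack_cheap n (S : sigScheme n) (q : nat) :
  (7 < q)%N -> (400 * q ^ 2 <= n)%N -> complete_with S (9 / 10 : R) -> total_queries_le S q ->
  exists A : adversary n,
    adv_queries_le A ((21 * q ^ 2 * 2 ^ q)%:R : R) /\ (2 ^+ q)^-1 <= break_pr R S A.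
Proof.
move=> q8 hn hc hq.
have [j ej] : exists j, q = (8 + j)%N by exists (q - 8)%N; rewrite subnKC.
pose W := (70 * 2 ^ j)%N.
have W0 : 0 < W%:R :> R by rewrite ltr0n muln_gt0 expn_gt0.
pose X : R := 2 ^+ q.
have X0 : 0 < X by rewrite exprn_gt0.
have eW : W%:R = 70 / 256 * X by rewrite /W /X ej exprD natrM natrX; lra.
have q0 : (0 < q)%N by apply: leq_trans q8.
(* One initial verification, one candidate and no tests. In units of 2^-q the success is 81 * 256 /
   14000, about 1.48, minus at most 1/4 for 2^-n and 1/10 for q / T. *)
have [|||A [hA1 hA2]] := @attack_exists n S q 1 0 1 (10 * q * 2 ^ q) (81 / 200 / W%:R - (2 ^ n)%:R^-1)
  (21 * q ^ 2 * 2 ^ q)%:R _ hq; last first.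
- exists A; split => //; apply: le_trans hA2.
  have -> : q%:R / (10 * q * 2 ^ q)%:R = X^-1 / 10 :> R.
    rewrite !natrM natrX -/X; field; rewrite gt_eqF //= pnatr_eq0; by case: (q) q0.
  have -> : 81 / 200 / W%:R = 81 * 256 / 14000 * X^-1 by rewrite eW; field; rewrite gt_eqF.
  have : (2 ^ n)%:R^-1 <= X^-1 / 4.
    have -> : X^-1 / 4 = (2 ^ (q + 2))%:R^-1 by rewrite natrX exprD -/X; field; rewrite gt_eqF.
    rewrite lef_pV2 ?posrE ?ltr0n ?expn_gt0 // ler_nat leq_exp2l //.
    by apply: leq_trans hn; rewrite expnS expn1; nia.
  have : 0 < X^-1 by rewrite invr_gt0.
  by rewrite -/X; lra.
- rewrite ler_nat !mul0n !mul1n addn0.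
  have -> : (10 * q * 2 ^ q * (q + q) = 20 * q ^ 2 * 2 ^ q)%N by rewrite expnS expn1; ring.
  have : (q <= q ^ 2 * 2 ^ q)%N by rewrite expnS expn1 -mulnA leq_pmulr // muln_gt0 q0 expn_gt0.
  by rewrite -!mulnA; lia.
- move=> L hL O [kk G] sk /=.
  apply: (single_sample_ge hL hq hc sk) => // i si.
  have [sc _] := supp_sample si; rewrite ler_nat.
  have h : (#|secret_set L G i| + #|ver_set L i| <= q)%N.
    apply: leq_trans (cand_queries hq sk sc); apply: leq_add; first exact: card_secret_set.
    by have := card_ver_set si; rewrite mul1n.
  apply: leq_trans (leq_bin2l _ h) _; rewrite ej; exact: bin_le_half.
- by rewrite !muln_gt0 q0 expn_gt0.
Qed.

End Attacks.

Local Open Scope classical_set_scope.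

(** * The o(1) term in the exponent *)

Section Exponent.
Variable R : realType.

(* Below [q = 8] the cheap attack is not available and the exponent is
   whatever the other attack needs. *)
Definition query_eps (q : nat) : R :=
  if (q < 8)%N then 50 * q%:R else 32 / Num.sqrt q%:R.

Lemma query_eps_cvg : query_eps @ \oo --> (0 : R).
Proof.
apply/cvgrPdist_lt => e e0; near=> q.
have q8 : (8 <= q)%N by near: q; exists 8%N.
have hq : (32 / e) ^+ 2 < q%:R.
  by near: q; apply: nbhs_infty_gtr.
have p0 : 0 < 32 / e by rewrite divr_gt0.
have s0 : 0 < Num.sqrt (q%:R : R) by rewrite sqrtr_gt0 ltr0n (leq_trans _ q8).
rewrite sub0r normrN /query_eps ltnNge q8 /= ger0_norm ?divr_ge0 ?sqrtr_ge0 //.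
rewrite ltr_pdivrMr // mulrC -ltr_pdivrMr // -ltr_sqr ?nnegrE ?sqrtr_ge0 ?ltW //.
by rewrite sqr_sqrtr.
Unshelve. all: by end_near.
Qed.

Lemma query_eps_small q : (0 < q)%N -> (q < 8)%N ->
  2 ^+ (50 * q ^ 2) <= 2 `^ ((1 + query_eps q) * q%:R) :> R.
Proof.
move=> q0 q8; rewrite /query_eps q8 -powR_mulrn // ler_powR ?ler1n //.
by rewrite natrM natrX expr2; have := ler0n R q; lra.
Qed.

Lemma query_eps_large q : (8 <= q)%N ->
  (21 * q ^ 2 * 2 ^ q)%:R <= 2 `^ ((1 + query_eps q) * q%:R) :> R.
Proof.
move=> q8; rewrite /query_eps ltnNge q8 /=.
have q0 : 0 < q%:R :> R by rewrite ltr0n (leq_trans _ q8).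
set s := Num.sqrt _; have s0 : 0 < s by rewrite sqrtr_gt0.
have es : s ^+ 2 = q%:R by rewrite sqr_sqrtr ?ltW.
have -> : (1 + 32 / s) * q%:R = q%:R + 32 * s by rewrite -es; field; rewrite gt_eqF.
rewrite powRD; last by rewrite pnatr_eq0 implybT.
rewrite powR_mulrn // natrM mulrC natrX; apply: ler_wpM2l; first by rewrite exprn_ge0.
apply: le_trans (powR2_ge (ltW s0)).
rewrite natrM natrX -es -exprM; apply: ler_wpM2r; first by rewrite exprn_ge0 // ltW.
by lra.
Qed.

End Exponent.

Lemma message_bound (R : realType) (n q : nat) :
  q%:R <= Num.sqrt (n%:R : R) / 20 -> (400 * q ^ 2 <= n)%N.
Proof.
rewrite ler_pdivlMr // => h; rewrite -(ler_nat R) natrM natrX.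
have : (q%:R * 20) ^+ 2 <= Num.sqrt (n%:R : R) ^+ 2.
  by apply: lerXn2r; rewrite ?nnegrE ?mulr_ge0 ?sqrtr_ge0.
by rewrite sqr_sqrtr // => h2; apply: le_trans h2; lra.
Qed.

Unset Implicit Arguments.

Theorem theorem6p7 (R : realType) :
  exists (eps : nat -> R) (C c : R),
    [/\ eps @ \oo --> (0 : R), 0 < c &
    forall (n q : nat) (S : sigScheme n),
      (0 < n)%N ->
      complete_with S (9 / 10 : R) ->
      total_queries_le S q ->
      q%:R <= Num.sqrt (n%:R : R) / 20 ->
      ((0 < q)%N ->
        exists A : adversary n,
          adv_queries_le A (2 `^ ((1 + eps q) * q%:R) : R) /\
          (2 ^+ q)^-1 <= break_pr R S A) /\
      (exists A : adversary n,
          adv_queries_le A (2 `^ (C * q%:R ^+ 2) : R) /\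
          c <= break_pr R S A)].
Proof.
exists (@query_eps R), 50, (1 / 2); split => [||n q S n0 hc hq /message_bound hn].
- exact: query_eps_cvg.
- by lra.
have [A [hA1 hA2]] := attack_const n0 hn hc hq.
split; last first.
  exists A; split=> // O vk m s; apply: le_trans (hA1 O vk m s) _.
  by rewrite -powR_mulrn // natrM natrX.
(* For [q < 8] the attack with success probability 1/2 already serves, as 2^-q <= 1/2 for positive
   [q]. *)
move=> q0; have [q8|q8] := ltnP q 8.
  exists A; split.
    by move=> O vk m s; apply: le_trans (hA1 O vk m s) _; apply: query_eps_small.
  apply: le_trans hA2; rewrite div1r lef_pV2 ?posrE ?exprn_gt0 //.
  by rewrite -{1}[2]expr1 ler_weXn2l // ler1n.
have [A' [hA'1 hA'2]] := attack_cheap q8 hn hc hq.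
exists A'; split=> // O vk m s; apply: le_trans (hA'1 O vk m s) _.
exact: query_eps_large.
Qed.
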